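(* Let $R$ be a commutative Noetherian ring with non-zero identity, $\mathfrak a$ an ideal of $R$, and $\mathcal S$ a Serre subcategory of the category of $R$-modules. Let $M$ be a finitely generated $R$-module, $X$ an arbitrary $R$-module, and $n$ a non-negative integer. Then: (a) If $H^r_{\mathfrak a}(X)\in\mathcal S$ for all $r$ with $0\le r<n$, then $\operatorname{Hom}_R(R/\mathfrak a,H^n_{\mathfrak a}(M,X))\in\mathcal S$ whenever $\operatorname{Ext}^n_R(M/\mathfrak aM,X)\in\mathcal S$. (b) If $H^r_{\mathfrak a}(X)=0$ for all $r$ with $0\le r<n$, then $\operatorname{Hom}_R(R/\mathfrak a,H^n_{\mathfrak a}(M,X))\cong\operatorname{Ext}^n_R(M/\mathfrak aM,X)$.
   Context: $H^i_{\mathfrak a}(M,X)=\varinjlim_{k}\operatorname{Ext}^i_R(M/\mathfrak a^kM,X)$ is the $i$-th generalized local cohomology module, and $H^i_{\mathfrak a}(X)=H^i_{\mathfrak a}(R,X)$ is ordinary local cohomology. A Serre subcategory $\mathcal S$ of the category of $R$-modules is a (nonempty) class of $R$-modules such that for every short exact sequence $0\to X'\to X\to X''\to 0$, $X\in\mathcal S$ if and only if $X',X''\in\mathcal S$. *)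

(* Defs.v *)
From HB Require Import structures.
From mathcomp Require Import all_boot all_algebra ring_quotient.
From mathcomp Require Import boolp.
From mathcomp.multinomials Require Import freeg.

Set Implicit Arguments.
Unset Strict Implicit.
Unset Printing Implicit Defensive.

Import GRing.Theory.
Local Open Scope ring_scope.
Local Open Scope quotient_scope.

(* Modules over R are inhabitants of [lmodType R]; the choice structure they
   carry is no restriction, by [gen_choiceMixin].  Submodules of V are
   predicates with a [submodClosed V] structure, and ideals of R (possibly
   improper) are submodules of the regular module [R^o]. *)

Section Submodules.
Variables (R : comNzRingType) (V : lmodType R).
Implicit Types (S : submodClosed V) (G : {pred V}).

Lemma submod_zmod_closed S : zmod_closed S.
Proof.
by split=> [|x y xS yS]; rewrite ?rpred0 // -scaleN1r rpredD // rpredZ.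
Qed.

Lemma submod_scaler_closed S : GRing.scaler_closed S.
Proof. by move=> c x xS; rewrite rpredZ. Qed.

(* [submodClosed] does not by itself provide closure under opposite in the
   eyes of type inference; [submod_pred S] is S with that structure added. *)
Definition submod_pred S : {pred V} := S.
HB.instance Definition _ S :=
  GRing.isZmodClosed.Build V (submod_pred S) (submod_zmod_closed S).
HB.instance Definition _ S :=
  GRing.isScaleClosed.Build R V (submod_pred S) (submod_scaler_closed (S := S)).

Record submod S : Type :=
  Submod { submod_val : V; _ : submod_val \in submod_pred S }.
HB.instance Definition _ S := [isSub of submod S for @submod_val S].
HB.instance Definition _ S := [Choice of submod S by <:].
HB.instance Definition _ S := [SubChoice_isSubLmodule of submod S by <:].

Definition quotmod S : Type := Quotient.quot (submod_pred S).
HB.instance Definition _ S := GRing.Zmodule.on (quotmod S).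
HB.instance Definition _ S := EqQuotient.on (quotmod S).

Definition quotmod_pi S (x : V) : quotmod S := \pi_(Quotient.quot (submod_pred S)) x.
Definition quotmod_repr S (u : quotmod S) : V :=
  repr (u : Quotient.quot (submod_pred S)).

Lemma quotmod_reprK S : cancel (@quotmod_repr S) (@quotmod_pi S).
Proof. exact: reprK. Qed.

Lemma quotmod_piE S x y : quotmod_pi S x = quotmod_pi S y <-> x - y \in S.
Proof.
rewrite -[x - y \in S]/(x - y \in submod_pred S) Quotient.idealrBE.
by split=> [/eqP|/eqP].
Qed.

Lemma quotmod_piD S : {morph quotmod_pi S : x y / x + y}.
Proof. by move=> x y; rewrite /quotmod_pi raddfD. Qed.

Definition quotmod_scale S (c : R) (u : quotmod S) : quotmod S :=
  quotmod_pi S (c *: quotmod_repr u).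

Lemma quotmod_scale_pi S c x :
  quotmod_scale c (quotmod_pi S x) = quotmod_pi S (c *: x).
Proof.
apply/quotmod_piE; rewrite -scalerBr rpredZ //.
by apply/quotmod_piE; rewrite quotmod_reprK.
Qed.

Lemma quotmod_scaleA S c d (u : quotmod S) :
  quotmod_scale c (quotmod_scale d u) = quotmod_scale (c * d) u.
Proof. by rewrite -[u]quotmod_reprK !quotmod_scale_pi scalerA. Qed.

Lemma quotmod_scale1 S : left_id 1 (@quotmod_scale S).
Proof. by move=> u; rewrite -[u]quotmod_reprK quotmod_scale_pi scale1r. Qed.

Lemma quotmod_scaleDr S : right_distributive (@quotmod_scale S) +%R.
Proof.
move=> c u v; rewrite -[u]quotmod_reprK -[v]quotmod_reprK.
by rewrite -quotmod_piD !quotmod_scale_pi scalerDr quotmod_piD.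
Qed.

Lemma quotmod_scaleDl S u :
  {morph (@quotmod_scale S)^~ u : c d / c + d}.
Proof.
move=> c d; rewrite -[u]quotmod_reprK !quotmod_scale_pi.
by rewrite scalerDl quotmod_piD.
Qed.

HB.instance Definition _ S := GRing.Zmodule_isLmodule.Build R (quotmod S)
  (@quotmod_scaleA S) (@quotmod_scale1 S) (@quotmod_scaleDr S)
  (@quotmod_scaleDl S).

Lemma quotmod_pi_linear S : linear (quotmod_pi S).
Proof. by move=> c x y; rewrite quotmod_piD -quotmod_scale_pi. Qed.
HB.instance Definition _ S :=
  GRing.isLinear.Build R V (quotmod S) _ (quotmod_pi S) (@quotmod_pi_linear S).

Definition span G : {pred V} :=
  [pred x | `[< forall S : submodClosed V, {subset G <= S} -> x \in S >]].

Lemma span_closed G : GRing.submod_closed (span G).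
Proof.
split=> [|c x y /asboolP xG /asboolP yG]; apply/asboolP=> S GS.
  exact: rpred0.
by rewrite rpredD ?rpredZ ?xG ?yG.
Qed.
HB.instance Definition _ G :=
  GRing.isSubmodClosed.Build R V (span G) (span_closed G).

Definition fg_submod (N : {pred V}) := exists s : seq V, N =i span [in s].

End Submodules.

Definition noetherian (R : comNzRingType) :=
  forall I : submodClosed R^o, fg_submod I.

Definition fg_module (R : comNzRingType) (M : lmodType R) :=
  fg_submod (predT : {pred M}).

Section Maps.
Variables (R : comNzRingType) (V W : lmodType R).

Section SubMap.
Variables (S : submodClosed V) (T : submodClosed W) (h : {linear V -> W}).
Hypothesis hST : {homo h : x / x \in S >-> x \in T}.

Definition submod_map (x : submod S) : submod T := Submod (hST (valP x)).

Lemma submod_map_linear : linear submod_map.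
Proof. by move=> c x y; apply/val_inj; rewrite /= linearP. Qed.
HB.instance Definition _ :=
  GRing.isLinear.Build R (submod S) (submod T) _ submod_map submod_map_linear.

Definition quotmod_map of {homo h : x / x \in S >-> x \in T} :=
  fun u : quotmod S => quotmod_pi T (h (quotmod_repr u)).

Lemma quotmod_map_pi x : quotmod_map hST (quotmod_pi S x) = quotmod_pi T (h x).
Proof.
apply/quotmod_piE; rewrite -linearB hST //.
by apply/quotmod_piE; rewrite quotmod_reprK.
Qed.

Lemma quotmod_map_linear : linear (quotmod_map hST).
Proof.
move=> c u v; rewrite -[u]quotmod_reprK -[v]quotmod_reprK.
by rewrite -linearP !quotmod_map_pi !linearP.
Qed.
HB.instance Definition _ := GRing.isLinear.Build R (quotmod S) (quotmod T) _
  (quotmod_map hST) quotmod_map_linear.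
End SubMap.

Definition ker_lin (h : {linear V -> W}) : {pred V} := [pred x | h x == 0].

Lemma ker_lin_closed h : GRing.submod_closed (ker_lin h).
Proof.
split=> [|c x y /eqP xh /eqP yh]; first by rewrite inE linear0.
by rewrite inE linearP xh yh scaler0 addr0.
Qed.
HB.instance Definition _ h :=
  GRing.isSubmodClosed.Build R V (ker_lin h) (ker_lin_closed h).

Definition im_lin (h : {linear V -> W}) : {pred W} :=
  [pred y | `[< exists x, y = h x >]].

Lemma im_lin_closed h : GRing.submod_closed (im_lin h).
Proof.
split=> [|c x y /asboolP[x' ->] /asboolP[y' ->]]; apply/asboolP.
  by exists 0; rewrite linear0.
by exists (c *: x' + y'); rewrite linearP.
Qed.
HB.instance Definition _ h :=
  GRing.isSubmodClosed.Build R W (im_lin h) (im_lin_closed h).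

End Maps.

Arguments submod_map {R V W S T h} hST x.
Arguments quotmod_map {R V W S T h} hST u.

Section Hom.
Variables (R : comNzRingType) (V W : lmodType R).
Implicit Types f g h : {linear V -> W}.

HB.instance Definition _ := gen_eqMixin {linear V -> W}.
HB.instance Definition _ := gen_choiceMixin {linear V -> W}.

Lemma linear_ext f g : f =1 g -> f = g.
Proof.
case: f g => f [a b] [g [a' b']] /= /funext fg; rewrite -{}fg in a' b' *.
case: a a' b b' => [a1] [a2] [b1] [b2] /=.
by rewrite (Prop_irrelevance a1 a2) (Prop_irrelevance b1 b2).
Qed.

Definition hom0 : {linear V -> W} := \0.
Definition homD f g : {linear V -> W} := f \+ g.
Definition homN f : {linear V -> W} := \- f.
Definition homZ (c : R) f : {linear V -> W} := c \*: f.

Lemma homDA : associative homD.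
Proof. by move=> f g h; apply/linear_ext => x /=; rewrite addrA. Qed.
Lemma homDC : commutative homD.
Proof. by move=> f g; apply/linear_ext => x /=; rewrite addrC. Qed.
Lemma hom0D : left_id hom0 homD.
Proof. by move=> f; apply/linear_ext => x /=; rewrite add0r. Qed.
Lemma homND : left_inverse hom0 homN homD.
Proof. by move=> f; apply/linear_ext => x /=; rewrite addNr. Qed.
HB.instance Definition _ :=
  GRing.isZmodule.Build {linear V -> W} homDA homDC hom0D homND.

Lemma homZA c d f : homZ c (homZ d f) = homZ (c * d) f.
Proof. by apply/linear_ext => x /=; rewrite scalerA. Qed.
Lemma hom1Z : left_id 1 homZ.
Proof. by move=> f; apply/linear_ext => x /=; rewrite scale1r. Qed.
Lemma homZDr : right_distributive homZ +%R.
Proof. by move=> c f g; apply/linear_ext => x /=; rewrite scalerDr. Qed.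
Lemma homZDl f : {morph homZ^~ f : c d / c + d}.
Proof. by move=> c d; apply/linear_ext => x /=; rewrite scalerDl. Qed.
HB.instance Definition _ :=
  GRing.Zmodule_isLmodule.Build R {linear V -> W} homZA hom1Z homZDr homZDl.

End Hom.

Section Precomp.
Variables (R : comNzRingType) (U V X : lmodType R) (h : {linear U -> V}).

Definition precomp (f : {linear V -> X}) : {linear U -> X} := f \o h.

Lemma precomp_linear : linear precomp.
Proof. by move=> c f g; apply/linear_ext. Qed.
HB.instance Definition _ := GRing.isLinear.Build R {linear V -> X}
  {linear U -> X} _ precomp precomp_linear.
End Precomp.

Section FreeResolution.
Variable R : comNzRingType.
Implicit Types A B : lmodType R.

Section Lift.
Variables (K : choiceType) (A : lmodType R) (f : K -> A).

HB.instance Definition _ := GRing.isZmodMorphism.Build {freeg K / R} A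
  (fglift f) (lift_is_additive f).

Lemma fglift_scalable : scalable (fglift f : {freeg K / R} -> A).
Proof.
move=> c D; have -> : c *: fglift f D =
  c *: \sum_(x <- dom D) fglift f << coeff x D *g x >>.
  by rewrite -[in LHS](freeg_sumE D) raddf_sum.
rewrite scaler_sumr [c *: D]/GRing.scale /= /fgscale raddf_sum.
by apply: eq_bigr => x _; rewrite /= !liftU scalerA.
Qed.
HB.instance Definition _ := GRing.isScalable.Build R {freeg K / R} A _
  (fglift f) fglift_scalable.

Lemma freeg_linear_ext (g h : {linear {freeg K / R} -> A}) :
  (forall k, g << k >> = h << k >>) -> g =1 h.
Proof.
move=> gh D; rewrite -[D]freeg_sumE !raddf_sum; apply: eq_bigr => x _ /=.
have -> : << coeff x D *g x >> = coeff x D *: << x >> :> {freeg K / R}.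
  by apply/eqP/freeg_eqP=> y; rewrite coeffZ !coeffU mul1r.
by rewrite /= !linearZ gh.
Qed.
End Lift.

(* The canonical free resolution of A: [syz A 0 = A], [resol A i] is the free
   module on the underlying set of [syz A i], and [syz A i.+1] is the kernel
   of the augmentation [resol A i -> syz A i]. *)
Definition aug A : {linear {freeg A / R} -> A} := fglift (@id A).

Definition syz1 A : lmodType R := submod (ker_lin (aug A)).
Definition syz A (i : nat) : lmodType R := iter i syz1 A.
Definition resol A (i : nat) : lmodType R := {freeg (syz A i) / R}.

Definition resol_d A (i : nat) : {linear resol A i.+1 -> resol A i} :=
  val \o aug (syz A i.+1).

Lemma aug_surjective A (x : A) : exists D, aug A D = x.
Proof. by exists << x >>; rewrite /aug /= liftU scale1r. Qed.

Lemma resol_exact A i (y : resol A i) :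
  aug (syz A i) y = 0 <-> exists z, resol_d A i z = y.
Proof.
split=> [y0|[z <-]]; last by apply/eqP; exact: (valP (aug _ z)).
have y_ker : y \in submod_pred (ker_lin (aug (syz A i))) by apply/eqP.
have [z zE] := aug_surjective (Submod y_ker : syz A i.+1).
by exists z; rewrite /resol_d /= zE.
Qed.

Section Functoriality.
Variables A B : lmodType R.

Definition free_map (h : A -> B) : {linear {freeg A / R} -> {freeg B / R}} :=
  fglift (fun a => << h a >>).

Lemma aug_free_map (h : {linear A -> B}) D : aug B (free_map h D) = h (aug A D).
Proof.
move: D; apply: (@freeg_linear_ext _ _ (aug B \o free_map h) (h \o aug A)).
by move=> a /=; rewrite !liftU !scale1r liftU scale1r.
Qed.

Lemma free_map_ker (h : {linear A -> B}) :
  {homo free_map h : D / D \in ker_lin (aug A) >-> D \in ker_lin (aug B)}.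
Proof. by move=> D; rewrite !inE aug_free_map => /eqP ->; rewrite linear0. Qed.

Definition syz1_map (h : {linear A -> B}) : {linear syz1 A -> syz1 B} :=
  submod_map (@free_map_ker h).
End Functoriality.

Section ResolMap.
Variables (A B : lmodType R) (h : {linear A -> B}).

Fixpoint syz_map (i : nat) : {linear syz A i -> syz B i} :=
  if i is j.+1 return {linear syz A i -> syz B i}
  then syz1_map (syz_map j) else h.

Definition resol_map (i : nat) : {linear resol A i -> resol B i} :=
  free_map (syz_map i).

Lemma resol_map_d i z :
  resol_d B i (resol_map i.+1 z) = resol_map i (resol_d A i z).
Proof. by rewrite /resol_d /= aug_free_map. Qed.
End ResolMap.
End FreeResolution.

Section Ext.
Variable R : comNzRingType.
Implicit Types A B X : lmodType R.

(* [Ext i A X] is the i-th cohomology of the complex Hom(resol A, X), which is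
   zero in degree -1. *)
Definition cochain A X (i : nat) : lmodType R := {linear resol A i -> X}.

Definition cobound A X (i : nat) : {linear cochain A X i -> cochain A X i.+1} :=
  precomp (X := X) (resol_d A i).

Definition coboundaries A X (i : nat) : submodClosed (cochain A X i) :=
  if i is j.+1 return submodClosed (cochain A X i)
  then im_lin (cobound A X j) else im_lin (\0 : {linear X -> cochain A X 0}).

Definition cocycle A X (i : nat) : lmodType R := submod (ker_lin (cobound A X i)).

Definition cocycle_coboundaries A X (i : nat) : {pred cocycle A X i} :=
  [pred z | val z \in coboundaries A X i].
Arguments cocycle_coboundaries : clear implicits.

Lemma cocycle_coboundaries_closed A X i :
  GRing.submod_closed (cocycle_coboundaries A X i).
Proof.
split=> [|c x y]; rewrite !inE ?rpred0 // => xB yB.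
by rewrite /= rpredD // rpredZ.
Qed.
HB.instance Definition _ A X i := GRing.isSubmodClosed.Build R (cocycle A X i)
  (cocycle_coboundaries A X i) (cocycle_coboundaries_closed A X i).

Definition Ext (i : nat) A X : lmodType R :=
  quotmod (cocycle_coboundaries A X i).

Section ExtMap.
Variables (A B X : lmodType R) (h : {linear A -> B}).

Definition cochain_map (i : nat) : {linear cochain B X i -> cochain A X i} :=
  precomp (X := X) (resol_map h i).

Lemma cochain_map_cobound j f :
  cobound A X j (cochain_map j f) = cochain_map j.+1 (cobound B X j f).
Proof.
by apply/linear_ext => z; apply: (congr1 f); rewrite -resol_map_d.
Qed.

Variable i : nat.

Lemma cochain_map_cocycle : {homo cochain_map i :
  f / f \in ker_lin (cobound B X i) >-> f \in ker_lin (cobound A X i)}.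
Proof.
by move=> f; rewrite !inE cochain_map_cobound => /eqP ->; rewrite linear0.
Qed.

Definition cocycle_map : {linear cocycle B X i -> cocycle A X i} :=
  submod_map cochain_map_cocycle.

Lemma cocycle_map_coboundaries : {homo cocycle_map :
  z / z \in cocycle_coboundaries B X i >-> z \in cocycle_coboundaries A X i}.
Proof.
move=> z; rewrite !inE /=; move: (submod_val z) => f {z}.
case: i f => [|j] f /asboolP[g ->]; apply/asboolP.
  by exists 0; rewrite !linear0.
by exists (cochain_map j g); rewrite cochain_map_cobound.
Qed.

Definition Ext_map : {linear Ext i B X -> Ext i A X} :=
  quotmod_map cocycle_map_coboundaries.
End ExtMap.
End Ext.

Section Colimit.
Variables (R : comNzRingType) (E : nat -> lmodType R).
Variable f : forall k, {linear E k -> E k.+1}.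

Definition seqprod : Type := forall k, E k.
HB.instance Definition _ := gen_eqMixin seqprod.
HB.instance Definition _ := gen_choiceMixin seqprod.
Implicit Types u v w : seqprod.

Definition seqprod0 : seqprod := fun k => 0.
Definition seqprodD u v : seqprod := fun k => u k + v k.
Definition seqprodN u : seqprod := fun k => - u k.
Definition seqprodZ (c : R) u : seqprod := fun k => c *: u k.

Lemma seqprodDA : associative seqprodD.
Proof. by move=> u v w; apply: functional_extensionality_dep => k; apply: addrA. Qed.
Lemma seqprodDC : commutative seqprodD.
Proof. by move=> u v; apply: functional_extensionality_dep => k; apply: addrC. Qed.
Lemma seqprod0D : left_id seqprod0 seqprodD.
Proof. by move=> u; apply: functional_extensionality_dep => k; apply: add0r. Qed.
Lemma seqprodND : left_inverse seqprod0 seqprodN seqprodD.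
Proof. by move=> u; apply: functional_extensionality_dep => k; apply: addNr. Qed.
HB.instance Definition _ :=
  GRing.isZmodule.Build seqprod seqprodDA seqprodDC seqprod0D seqprodND.

Lemma seqprodZA c d u : seqprodZ c (seqprodZ d u) = seqprodZ (c * d) u.
Proof. by apply: functional_extensionality_dep => k; apply: scalerA. Qed.
Lemma seqprod1Z : left_id 1 seqprodZ.
Proof. by move=> u; apply: functional_extensionality_dep => k; apply: scale1r. Qed.
Lemma seqprodZDr : right_distributive seqprodZ +%R.
Proof. by move=> c u v; apply: functional_extensionality_dep => k; apply: scalerDr. Qed.
Lemma seqprodZDl u : {morph seqprodZ^~ u : c d / c + d}.
Proof. by move=> c d; apply: functional_extensionality_dep => k; apply: scalerDl. Qed.
HB.instance Definition _ := GRing.Zmodule_isLmodule.Build R seqprod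
  seqprodZA seqprod1Z seqprodZDr seqprodZDl.

(* The direct limit of E 0 -> E 1 -> ..., as the eventually compatible
   sequences modulo the eventually zero ones; [colim_in_surj] and
   [colim_in_eq0] characterize it. *)
Definition compatible : {pred seqprod} :=
  [pred u | `[< exists N, forall k, (N <= k)%N -> f k (u k) = u k.+1 >]].

Lemma compatible_closed : GRing.submod_closed compatible.
Proof.
split=> [|c u v /asboolP[m mu] /asboolP[n nv]]; apply/asboolP.
  by exists 0%N => k _; apply: linear0.
exists (maxn m n) => k; rewrite geq_max => /andP[mk nk].
by rewrite [LHS]linearP mu ?nv.
Qed.
HB.instance Definition _ :=
  GRing.isSubmodClosed.Build R seqprod compatible compatible_closed.

Definition evzero : {pred submod compatible} :=
  [pred u : submod compatible |
    `[< exists N, forall k, (N <= k)%N -> val u k = 0 >]].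

Lemma evzero_closed : GRing.submod_closed evzero.
Proof.
split=> [|c u v /asboolP[m mu] /asboolP[n nv]]; apply/asboolP.
  by exists 0%N.
exists (maxn m n) => k; rewrite geq_max => /andP[mk nk].
have -> : val (c *: u + v) k = c *: val u k + val v k by [].
by rewrite mu ?nv // scaler0 addr0.
Qed.
HB.instance Definition _ :=
  GRing.isSubmodClosed.Build R (submod compatible) evzero evzero_closed.

Definition colim : lmodType R := quotmod evzero.

(* [push x j] is the image of [x : E k] in [E j] if k <= j, and 0 if j < k. *)
Fixpoint push k (x : E k) (j : nat) : E j :=
  match k =P j with
  | ReflectT e => ecast i (E i) e x
  | ReflectF _ => if j is i.+1 return E j then f i (push x i) else 0
  end.

Lemma push_id k x : @push k x k = x.
Proof. by case: k x => [|k] x /=; case: eqP => // e; rewrite eq_axiomK. Qed.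

Lemma pushS k (x : E k) j : (k <= j)%N -> push x j.+1 = f j (push x j).
Proof. by move=> kj /=; case: eqP => // e; move: kj; rewrite {1}e ltnn. Qed.

Lemma push_linear k j : linear ((@push k)^~ j).
Proof.
move=> c x y; elim: j => [|j IHj] /=; case: eqP => e.
- by case: _ / e.
- by rewrite scaler0 addr0.
- by case: _ / e.
- by rewrite IHj linearP.
Qed.

Lemma push_compatible k (x : E k) : (push x : seqprod) \in submod_pred compatible.
Proof. by apply/asboolP; exists k => j kj; rewrite pushS. Qed.

Definition colim_in k (x : E k) : colim :=
  quotmod_pi evzero (Submod (push_compatible x)).

Lemma colim_in_linear k : linear (@colim_in k).
Proof.
move=> c x y; rewrite /colim_in -linearP; congr quotmod_pi.
by apply/val_inj/functional_extensionality_dep => j; apply: push_linear.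
Qed.
HB.instance Definition _ k :=
  GRing.isLinear.Build R (E k) colim _ (@colim_in k) (@colim_in_linear k).

Lemma colim_inS k (x : E k) : colim_in (f k x) = colim_in x.
Proof.
apply/quotmod_piE/asboolP; exists k.+1 => j kj.
have -> : val (Submod (push_compatible (f k x)) -
  Submod (push_compatible x)) j = push (f k x) j - push x j by [].
apply/eqP; rewrite subr_eq0; apply/eqP.
elim: j kj => // j IHj; rewrite ltnS leq_eqVlt => /predU1P[<-|kj].
  by rewrite push_id pushS ?push_id.
by rewrite !pushS ?IHj // ltnW.
Qed.

Lemma colim_in_surj (z : colim) : exists k (x : E k), z = colim_in x.
Proof.
rewrite -[z]quotmod_reprK; case: (quotmod_repr z) => u uP.
have /asboolP[N uN] := uP; exists N, (u N).
apply/quotmod_piE/asboolP; exists N => j.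
have -> : val (Submod uP - Submod (push_compatible (u N))) j =
  u j - push (u N) j by [].
move=> Nj; apply/eqP; rewrite subr_eq0; apply/eqP.
elim: j Nj => [|j IHj]; first by rewrite leqn0 => /eqP->; rewrite push_id.
rewrite leq_eqVlt => /predU1P[<-|Nj]; first by rewrite push_id.
by rewrite pushS -?IHj ?uN.
Qed.

Lemma colim_in_eq0 k (x : E k) :
  colim_in x = 0 <-> exists2 j, (k <= j)%N & push x j = 0.
Proof.
rewrite -[0](linear0 (quotmod_pi evzero)); split.
  move=> /quotmod_piE; rewrite subr0 => /asboolP[N xN].
  by exists (maxn k N); [exact: leq_maxl | exact/xN/leq_maxr].
case=> j kj xj; apply/quotmod_piE; rewrite subr0; apply/asboolP; exists j.
suff key i : (j <= i)%N -> push x i = 0 by exact: key.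
elim: i => [|i IHi]; first by rewrite leqn0 => /eqP e; rewrite -{}e xj.
rewrite leq_eqVlt => /predU1P[<- //|ji].
by rewrite pushS ?IHi ?linear0 // (leq_trans kj).
Qed.

End Colimit.

Section IdealProducts.
Variable R : comNzRingType.

Definition prodmod (M : lmodType R) (I : {pred R^o}) (N : {pred M}) :
    submodClosed M :=
  span [pred y | `[< exists x n, [/\ x \in I, n \in N & y = (x : R) *: n] >]].

Fixpoint idealX (a : {pred R^o}) (k : nat) : {pred R^o} :=
  if k is j.+1 then prodmod a (idealX a j) else predT.

Lemma prodmodS (M : lmodType R) (I J : {pred R^o}) (N : {pred M}) :
  {subset I <= J} -> {subset prodmod I N <= prodmod J N}.
Proof.
move=> IJ y /asboolP yIN; apply/asboolP => S JS; apply: yIN => z.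
case/asboolP=> x [n [xI nN zE]]; apply: JS; apply/asboolP.
by exists x, n; rewrite IJ.
Qed.

Lemma idealXS a k : {subset idealX a k.+1 <= idealX a k}.
Proof.
case: k => [//|k] y /asboolP yak; apply: yak => z /asboolP[x [n [_ nk ->]]].
exact: rpredZ.
Qed.
End IdealProducts.

Section LocalCohomology.
Variables (R : comNzRingType) (a : submodClosed R^o).
Implicit Types M X : lmodType R.

(* M / a^k M *)
Definition quotX M (k : nat) : lmodType R :=
  quotmod (prodmod (idealX a k) (predT : {pred M})).

Definition quotX_proj M (k : nat) : {linear quotX M k.+1 -> quotX M k} :=
  quotmod_map (h := idfun) (prodmodS (@idealXS R a k)).

(* The limit starts at k = 0, where M / a^0 M = 0. *)
Definition gen_local_cohomology (i : nat) M X : lmodType R :=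
  colim (fun k => Ext_map X (quotX_proj M k) i).

Definition local_cohomology (i : nat) X : lmodType R :=
  gen_local_cohomology i R^o X.

End LocalCohomology.

Section SerreSubcategories.
Variable R : comNzRingType.

Definition short_exact (X' X X'' : lmodType R)
    (f : {linear X' -> X}) (g : {linear X -> X''}) :=
  [/\ injective f, forall z, exists y, g y = z
    & forall y, g y = 0 <-> exists x, f x = y].

Definition serre_subcategory (S : lmodType R -> Prop) :=
  (exists X, S X) /\
  forall (X' X X'' : lmodType R)
    (f : {linear X' -> X}) (g : {linear X -> X''}),
    short_exact f g -> (S X <-> S X' /\ S X'').

Definition zero_module (X : lmodType R) := forall x : X, x = 0.

Definition isomorphic (X Y : lmodType R) :=
  exists f : {linear X -> Y}, bijective f.
End SerreSubcategories.

(* Main.v *)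
From HB Require Import structures.
From mathcomp Require Import all_boot all_algebra.
From mathcomp Require Import boolp.
From mathcomp.multinomials Require Import freeg.
Require Import Defs.

(** Write T^i(N) for the generalized local cohomology module H^i_a(N, X), the
    direct limit over k of Ext^i(N / a^k N, X).  The key fact is that, on finitely
    generated modules, T behaves like a contravariant cohomological functor: a
    short exact sequence 0 -> A -> B -> C -> 0 makes T^i(C) -> T^i(B) -> T^i(A)
    exact ([lc_exact]), the map T^0(C) -> T^0(B) injective ([lc_map_inj0]), and the
    kernel of T^{i+1}(C) -> T^{i+1}(B) a quotient of a submodule of T^i(A)
    ([lc_connected]).  Indeed Ext has a long exact sequence for each
    0 -> A / (A n a^k B) -> B / a^k B -> C / a^k C -> 0, and by the Artin-Rees
    property ([artin_rees]) the filtration (A n a^k B) of A may be replaced by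
    (a^k A) in the limit.  The sequence for Ext comes from the canonical free
    resolutions: when B -> C is onto, so is the map between their resolutions, and
    its kernel is a projective resolution of A ([kernel_resolution]).

    Now let S be a Serre class containing T^r(R) = H^r_a(X) for all r < n.  By
    induction on r and on the number of generators, S contains T^r(N) for every
    finitely generated N and every r < n ([serre_lc]); so, up to S, the functor T^n
    is left exact.  The module Hom(R/a, T^n(M)) is the part of T^n(M) annihilated
    by a, to be compared with T^n(M / aM), which is Ext^n(M / aM, X) because a
    annihilates M / aM ([Ext_lc_torsion]).  In
    T^n(M / aM) -> T^n(M) -> T^n(aM), the kernel of the first map is in S.
    An element t of T^n(M) annihilated by a goes in T^n(aM) to an element killed by
    the maps T^n(aM) -> T^n(M) induced by the multiplications x : M -> aM, for x in
    a, since the composite sends t to x t.  Finitely many of these multiplications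
    have images generating aM, and so the common kernel of the maps they induce is
    in S ([serre_joint_kernel]).  Hence Hom(R/a, T^n(M)) is an extension of a module
    of S by a quotient of Ext^n(M / aM, X), which proves (a).  When S is the class of
    zero modules, both error terms vanish: the first map is injective, and its image
    is exactly the part annihilated by a, which proves (b). *)

Set Implicit Arguments.
Unset Strict Implicit.
Unset Printing Implicit Defensive.

Import GRing.Theory.
Local Open Scope ring_scope.

(** * Linear maps, submodules and quotients *)

Section LinearAlgebra.
Variable R : comNzRingType.
Implicit Types A B C K P Q T V W X Y Z : lmodType R.

Definition surjection V W (f : V -> W) := forall y, exists x, f x = y.

Definition linear_of V W (f : V -> W) (f_lin : linear f) : {linear V -> W} :=
  HB.pack f (GRing.isLinear.Build R V W *:%R f f_lin).

Lemma linear_injP V W (f : {linear V -> W}) :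
  (forall x, f x = 0 -> x = 0) -> injective f.
Proof.
move=> f0 x y fxy; apply/eqP; rewrite -subr_eq0; apply/eqP/f0.
by rewrite linearB fxy subrr.
Qed.

Lemma factor_surj A K Q (p : {linear A -> K}) (q : {linear A -> Q}) :
    surjection p -> (forall x, p x = 0 -> q x = 0) ->
  exists r : {linear K -> Q}, forall x, r (p x) = q x.
Proof.
move=> /choice[s sK] pq.
have pqE x y : p x = p y -> q x = q y.
  by move=> e; apply/eqP; rewrite -subr_eq0 -linearB pq // linearB e subrr.
have r_lin : linear (q \o s).
  by move=> c x y /=; rewrite -linearP; apply: pqE; rewrite linearP !sK.
by exists (linear_of r_lin) => x; apply: pqE; rewrite sK.
Qed.

Lemma factor_inj P Y Z (i : {linear Z -> Y}) (q : {linear P -> Y}) :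
    injective i -> (forall x, exists z, i z = q x) ->
  exists t : {linear P -> Z}, forall x, i (t x) = q x.
Proof.
move=> i_inj /choice[t tK].
have t_lin : linear t by move=> c x y; apply: i_inj; rewrite linearP !tK linearP.
by exists (linear_of t_lin).
Qed.

Definition projective P := forall V W (p : {linear V -> W}) (f : {linear P -> W}),
  surjection p -> exists g : {linear P -> V}, forall x, p (g x) = f x.

Lemma freeg_projective (I : choiceType) : projective {freeg I / R}.
Proof.
move=> V W p f /choice[s sK].
exists (fglift (fun k => s (f << k >>)) : {linear {freeg I / R} -> V}) => x.
have := @freeg_linear_ext _ _ _
  (p \o (fglift (fun k => s (f << k >>)) : {linear {freeg I / R} -> V})) f.
by apply=> k /=; rewrite liftU scale1r sK.
Qed.

Lemma retract_projective P Q (i : {linear Q -> P}) (r : {linear P -> Q}) :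
  cancel i r -> projective P -> projective Q.
Proof.
move=> iK P_proj V W p f /(P_proj _ _ p (f \o r))[g gE].
by exists (g \o i) => x /=; rewrite gE /= iK.
Qed.

Section KernelLift.
Variables (Z P Q : lmodType R) (h : {linear P -> Q}) (q : {linear Z -> P}).
Hypothesis hq0 : forall z, h (q z) = 0.

Lemma kernel_lift_subproof z : q z \in submod_pred (ker_lin h).
Proof. by apply/eqP. Qed.

Definition kernel_lift_fun z : submod (ker_lin h) := Submod (kernel_lift_subproof z).

Lemma kernel_lift_linear : linear kernel_lift_fun.
Proof. by move=> c x y; apply: val_inj; rewrite /= linearP. Qed.

Definition kernel_lift : {linear Z -> submod (ker_lin h)} :=
  linear_of kernel_lift_linear.
End KernelLift.

Lemma short_exact0 A B C (f : {linear A -> B}) (g : {linear B -> C}) :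
  short_exact f g -> forall x, g (f x) = 0.
Proof. by case=> _ _ fg x; apply/fg; exists x. Qed.

Lemma ker_val_onto V W (h : {linear V -> W}) y :
  h y = 0 -> exists x : submod (ker_lin h), val x = y.
Proof.
move=> y0; have y_ker : y \in submod_pred (ker_lin h) by apply/eqP.
by exists (Submod y_ker).
Qed.

Lemma ker_val0 V W (h : {linear V -> W}) (x : submod (ker_lin h)) : h (val x) = 0.
Proof. by apply/eqP; exact: (valP x). Qed.

Lemma im_corestrict V W (h : {linear V -> W}) :
  exists2 h' : {linear V -> submod (im_lin h)},
    surjection h' & forall x, val (h' x) = h x.
Proof.
have [|h' h'E] := factor_inj (i := (val : {linear submod (im_lin h) -> W})) (q := h) val_inj.
  move=> x; have hx : h x \in submod_pred (im_lin h) by apply/asboolP; exists x.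
  by exists (Submod hx).
exists h' => // y; have /asboolP[x xE] := valP y; exists x; apply: val_inj.
by rewrite h'E; exact/esym.
Qed.

Lemma quotmod_pi_surj V (N : submodClosed V) : surjection (quotmod_pi N).
Proof. by move=> u; exists (quotmod_repr u); apply: quotmod_reprK. Qed.

Lemma quotmod_pi0P V (N : submodClosed V) x : quotmod_pi N x = 0 <-> x \in N.
Proof. by rewrite -(linear0 (quotmod_pi N)) quotmod_piE subr0. Qed.

Lemma short_exact_ker B C (g : {linear B -> C}) : surjection g ->
  short_exact (val : {linear submod (ker_lin g) -> B}) g.
Proof.
move=> g_surj; split=> [|//|y]; first exact: val_inj.
by split=> [/ker_val_onto[x <-]|[x <-]]; [exists x | apply: ker_val0].
Qed.

Lemma short_exact_quot B (N : submodClosed B) :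
  short_exact (val : {linear submod N -> B}) (quotmod_pi N).
Proof.
split=> [||y]; [exact: val_inj | exact: quotmod_pi_surj | rewrite quotmod_pi0P].
by split=> [yN|[x <-]]; [exists (Submod (yN : y \in submod_pred N)) | exact: (valP x)].
Qed.

Lemma isomorphic_same_image A B T (i : {linear A -> T}) (j : {linear B -> T}) :
    injective i -> injective j ->
    (forall x, exists y, j y = i x) -> (forall y, exists x, i x = j y) ->
  isomorphic A B.
Proof.
move=> i_inj j_inj ij ji; have [h hE] := factor_inj j_inj ij.
have /choice[k kE] := ji; exists h, k => [x|y].
  by apply: i_inj; rewrite kE hE.
by apply: j_inj; rewrite hE kE.
Qed.

End LinearAlgebra.

(** * Resolutions as towers of short exact sequences *)

Section Towers.
Variable R : comNzRingType.

(** A resolution of [tsyz 0], cut into its short exact sequences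
    0 -> tsyz i.+1 -> tcov i -> tsyz i -> 0.  Cohomology of Hom(-, X) is then read
    off the linear maps out of the syzygies, and no differential is needed. *)
Record tower := Tower {
  tsyz : nat -> lmodType R;
  tcov : nat -> lmodType R;
  tproj : forall i, {linear tcov i -> tsyz i};
  tinc : forall i, {linear tsyz i.+1 -> tcov i};
  tproj_surj : forall i, surjection (tproj i);
  tinc_inj : forall i, injective (tinc i);
  tower_exact : forall i y, tproj i y = 0 <-> exists z, tinc i z = y }.

Record tower_map (P Q : tower) := TowerMap {
  msyz : forall i, {linear tsyz P i -> tsyz Q i};
  mcov : forall i, {linear tcov P i -> tcov Q i};
  mproj : forall i y, tproj Q i (mcov i y) = msyz i (tproj P i y);
  minc : forall i z, tinc Q i (msyz i.+1 z) = mcov i (tinc P i z) }.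

(** The coboundaries: a cocycle of degree i of Hom(tcov, X) is a map tsyz i -> X, and
    it is a coboundary when it extends to the previous cover. *)
Definition bounds (P : tower) (X : lmodType R) (i : nat) :
    {linear tsyz P i -> X} -> Prop :=
  if i is j.+1 return {linear tsyz P i -> X} -> Prop
  then fun f => exists g : {linear tcov P j -> X}, forall z, f z = g (tinc P j z)
  else fun f => forall z, f z = 0.

Lemma tproj_inc (P : tower) i z : tproj P i (tinc P i z) = 0.
Proof. by apply/tower_exact; exists z. Qed.

(** The comparison theorem for projective resolutions, in the form used below.  One
    builds a lift v of v0 from P to Q, degree by degree, together with a homotopy
    t from u \o v to w; composing f with both shows that f \o w is bounded as soon
    as f \o u is. *)
Lemma tower_comparison (P Q P' : tower) (u : tower_map Q P') (w : tower_map P P')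
    (v0 : {linear tsyz P 0 -> tsyz Q 0}) :
    (forall i, projective (tcov P i)) ->
    (forall z, msyz w 0 z = msyz u 0 (v0 z)) ->
  forall (X : lmodType R) i (f : {linear tsyz P' i -> X}),
    bounds (P := Q) (f \o msyz u i) -> bounds (P := P) (f \o msyz w i).
Proof.
move=> P_proj v0E X.
pose comparable i : {linear tsyz P i -> tsyz Q i} -> Prop :=
  if i is j.+1 return {linear tsyz P i -> tsyz Q i} -> Prop then
    fun v => exists (V : {linear tcov P j -> tcov Q j})
                    (t : {linear tcov P j -> tsyz P' j.+1}),
      (forall z, tinc Q j (v z) = V (tinc P j z)) /\
      (forall z, msyz w j.+1 z = msyz u j.+1 (v z) + t (tinc P j z))
  else fun v => forall z, msyz w 0 z = msyz u 0 (v z).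
have lift i v : comparable i v ->
  exists s : {linear tcov P i -> tcov P' i},
    (forall y, tproj P' i (s y) = msyz w i (tproj P i y) - msyz u i (v (tproj P i y)))
    /\ (forall z, s (tinc P i z) = 0).
  case: i v => [|j] v /=.
    by move=> vE; exists \0; split=> // y; rewrite linear0 vE subrr.
  case=> V [t [_ tE]].
  (* Here w - u \o v extends to a map t on a cover, and a lift of w - u \o v that
     goes through t vanishes on the next syzygy. *)
  have [s sE] := P_proj j _ _ (tproj P' j.+1) t (@tproj_surj P' j.+1).
  exists ((s \o tinc P j) \o tproj P j.+1); split=> [y|z] /=.
    by rewrite sE tE addrC addKr.
  by rewrite tproj_inc !linear0.
move=> i; have [v vE] : exists v, comparable i v.
  elim: i => [|i [v /lift[s [sE s0]]]]; first by exists v0.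
  have [V VE] := P_proj i _ _ (tproj Q i) (v \o tproj P i) (@tproj_surj Q i).
  have [|v' v'E] := factor_inj (q := V \o tinc P i) (@tinc_inj Q i).
    by move=> z; apply/tower_exact; rewrite VE /= tproj_inc linear0.
  have [|t tE] := factor_inj (q := (mcov w i \- (mcov u i \o V)) \- s) (@tinc_inj P' i).
    move=> y; apply/tower_exact; rewrite /= !linearB /= sE !mproj VE /=.
    by rewrite subrr.
  exists v', V, t; split=> // z; apply: (@tinc_inj P' i).
  by rewrite linearD tE /= s0 subr0 !minc v'E /= addrC subrK.
case: i v vE => [|j] v /= vE f; first by move=> fu z; rewrite /= vE; apply: fu.
case: vE => V [t [VE tE]] [g gE].
exists ((g \o V) \+ (f \o t)) => z /=.
by rewrite tE linearD -VE -gE.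
Qed.

(** Lifts of the zero map induce zero in cohomology: compare w with the zero map of
    towers. *)
Lemma tower_map_null (P P' : tower) (w : tower_map P P') :
    (forall i, projective (tcov P i)) -> (forall z, msyz w 0 z = 0) ->
  forall (X : lmodType R) i (f : {linear tsyz P' i -> X}),
    bounds (P := P) (f \o msyz w i).
Proof.
move=> P_proj w0 X i f.
pose u : tower_map P' P' := @TowerMap P' P' (fun=> \0) (fun=> \0)
  (fun _ _ => linear0 _) (fun _ _ => linear0 _).
apply: (@tower_comparison P P' P' u w \0) => //.
by case: i f => [|i] f /=; [move=> ?; rewrite linear0 | exists \0 => z /=; rewrite linear0].
Qed.

End Towers.

(** * Canonical free resolutions and their kernels *)

Section Resolutions.
Variable R : comNzRingType.
Implicit Types A B C X : lmodType R.

Lemma free_mapU A B (h : A -> B) a : free_map h << a >> = << h a >>.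
Proof. by rewrite /free_map /= liftU scale1r. Qed.

Lemma eq_free_map A B (h1 h2 : A -> B) : h1 =1 h2 -> free_map h1 =1 free_map h2.
Proof. by move=> /funext->. Qed.

Lemma free_map_comp A B C (g : B -> C) (h : A -> B) D :
  free_map (g \o h) D = free_map g (free_map h D).
Proof.
move: D; apply: (@freeg_linear_ext _ _ _ _ (free_map g \o free_map h)) => a.
by rewrite /= !free_mapU.
Qed.

Lemma free_map_id A (h : A -> A) D : h =1 id -> free_map h D = D.
Proof.
move=> h_id; move: D; apply: (@freeg_linear_ext _ _ _ _ idfun) => a.
by rewrite free_mapU h_id.
Qed.

Lemma syz_map_comp A B C (g : {linear B -> C}) (h : {linear A -> B}) i z :
  syz_map (g \o h) i z = syz_map g i (syz_map h i z).
Proof.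
elim: i z => [//|i IHi] z; apply: val_inj; rewrite /= -free_map_comp.
exact/eq_free_map.
Qed.

Lemma resol_map_comp A B C (g : {linear B -> C}) (h : {linear A -> B}) i z :
  resol_map (g \o h) i z = resol_map g i (resol_map h i z).
Proof. by rewrite /resol_map -free_map_comp; apply/eq_free_map/syz_map_comp. Qed.

Lemma syz_map_id A i z : syz_map (idfun : {linear A -> A}) i z = z.
Proof.
by elim: i z => [//|i IHi] z; apply: val_inj; rewrite /= free_map_id.
Qed.

Lemma aug_surj A : surjection (aug A).
Proof. exact: aug_surjective. Qed.

Definition syz_inc A i : {linear syz A i.+1 -> resol A i} :=
  (val : submod (ker_lin (aug (syz A i))) -> _).

Lemma syz_inc_inj A i : injective (syz_inc A i).
Proof. exact: val_inj. Qed.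

Lemma syz_exact A i y : aug (syz A i) y = 0 <-> exists z, syz_inc A i z = y.
Proof.
by split=> [/ker_val_onto[z <-]|[z <-]]; [exists z | apply: ker_val0].
Qed.

Definition resolution A : tower R :=
  Tower (fun i => @aug_surj (syz A i)) (@syz_inc_inj A) (@syz_exact A).

Lemma syz_map_proj A B (h : {linear A -> B}) i y :
  aug (syz B i) (resol_map h i y) = syz_map h i (aug (syz A i) y).
Proof. exact: aug_free_map. Qed.

Lemma syz_map_inc A B (h : {linear A -> B}) i z :
  syz_inc B i (syz_map h i.+1 z) = resol_map h i (syz_inc A i z).
Proof. by []. Qed.

(** A section s of h on elements lifts a cycle z of B to a chain y of A, which may
    fail to be a cycle.  Its augmentation a is killed by h, so subtracting
    << a >> - << 0 >> turns y into a cycle without changing its image. *)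
Lemma syz_map_surj A B (h : {linear A -> B}) :
  surjection h -> forall i, surjection (syz_map h i).
Proof.
move=> h_surj; elim=> [//|i /choice[s sK]] z.
pose y := free_map s (syz_inc B i z).
have yE : resol_map h i y = syz_inc B i z.
  by rewrite /resol_map -free_map_comp; apply: free_map_id.
pose a := aug _ y.
have a0 : syz_map h i a = 0.
  by rewrite -syz_map_proj yE; apply/syz_exact; exists z.
have [x xE] : exists x, syz_inc A i x = y - << a >> + << 0 >>.
  apply/syz_exact; rewrite linearD linearB /=.
  by rewrite /aug /= !liftU !scale1r addr0 subrr.
exists x; apply: syz_inc_inj; rewrite syz_map_inc xE linearD linearB /=.
by rewrite yE !free_mapU a0 linear0 subrK.
Qed.

Lemma resol_map_section A B (h : {linear A -> B}) i : surjection h ->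
  exists s : {linear resol B i -> resol A i}, cancel s (resol_map h i).
Proof.
move=> h_surj; have /choice[s sK] : surjection (syz_map h i) by exact: syz_map_surj.
by exists (free_map s) => y; rewrite /resol_map -free_map_comp; apply: free_map_id.
Qed.

Section KernelResolution.
Variables (B C : lmodType R) (g : {linear B -> C}).

(** The kernels of the maps of resolutions induced by g.  For g surjective they form
    a projective resolution of the kernel of g, and each
    0 -> kcov i -> resol B i -> resol C i -> 0 splits; the canonical resolution of
    the kernel of g has no such relation to those of B and C. *)
Definition kcov i : lmodType R := submod (ker_lin (resol_map g i)).
Definition ksyz i : lmodType R := submod (ker_lin (syz_map g i)).

Definition kcov_val i : {linear kcov i -> resol B i} :=
  (val : submod (ker_lin (resol_map g i)) -> _).
Definition ksyz_val i : {linear ksyz i -> syz B i} :=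
  (val : submod (ker_lin (syz_map g i)) -> _).

Lemma ksyz_valP i y : syz_map g i y = 0 -> exists z, ksyz_val i z = y.
Proof. exact: ker_val_onto. Qed.

Lemma ksyz_val0 i z : syz_map g i (ksyz_val i z) = 0.
Proof. exact: ker_val0. Qed.

Lemma kcov_valP i y : resol_map g i y = 0 -> exists z, kcov_val i z = y.
Proof. exact: ker_val_onto. Qed.

Lemma kcov_val0 i z : resol_map g i (kcov_val i z) = 0.
Proof. exact: ker_val0. Qed.

Lemma kproj_subproof i : {homo aug (syz B i) :
  y / y \in ker_lin (resol_map g i) >-> y \in ker_lin (syz_map g i)}.
Proof. by move=> y; rewrite !inE -syz_map_proj => /eqP->; rewrite linear0. Qed.

Lemma kinc_subproof i : {homo syz_inc B i :
  z / z \in ker_lin (syz_map g i.+1) >-> z \in ker_lin (resol_map g i)}.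
Proof. by move=> z; rewrite !inE -syz_map_inc => /eqP->; rewrite linear0. Qed.

Definition kproj i : {linear kcov i -> ksyz i} := submod_map (@kproj_subproof i).
Definition kinc i : {linear ksyz i.+1 -> kcov i} := submod_map (@kinc_subproof i).

Lemma ksyz_val_proj i y : ksyz_val i (kproj i y) = aug (syz B i) (kcov_val i y).
Proof. by []. Qed.

Lemma kcov_val_inc i z : kcov_val i (kinc i z) = syz_inc B i (ksyz_val i.+1 z).
Proof. by []. Qed.

Lemma kproj_surj i : surjection (kproj i).
Proof.
(* << z >> alone is not in the kernel: its image is << 0 >>. *)
move=> z; have [|y yE] := @kcov_valP i (<< ksyz_val i z >> - << 0 >>).
  by rewrite linearB /= !free_mapU ksyz_val0 linear0 subrr.
exists y; apply: val_inj; rewrite -[LHS]/(ksyz_val i _) ksyz_val_proj yE linearB.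
by rewrite /aug /= !liftU !scale1r subr0.
Qed.

Lemma kinc_inj i : injective (kinc i).
Proof. by move=> x y /(congr1 val) /= /val_inj /val_inj. Qed.

Lemma kernel_exact i y : kproj i y = 0 <-> exists z, kinc i z = y.
Proof.
split=> [/(congr1 (ksyz_val i))|[z <-]].
  rewrite ksyz_val_proj linear0 => /syz_exact[z zE].
  have [|w wE] := @ksyz_valP i.+1 z.
    by apply: syz_inc_inj; rewrite syz_map_inc zE kcov_val0 linear0.
  exists w; apply: val_inj; rewrite -[LHS]/(kcov_val i _) kcov_val_inc wE.
  exact: zE.
apply: val_inj; rewrite -[LHS]/(ksyz_val i _) ksyz_val_proj kcov_val_inc.
by apply/syz_exact; eexists.
Qed.

Definition kernel_resolution : tower R :=
  Tower kproj_surj kinc_inj kernel_exact.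

Hypothesis g_surj : surjection g.

Lemma kcov_retract i : exists r : {linear resol B i -> kcov i}, cancel (kcov_val i) r.
Proof.
have [s sK] := resol_map_section i g_surj.
have [|r rE] := factor_inj (i := kcov_val i)
  (q := idfun \- (s \o resol_map g i)) (fun _ _ => @val_inj _ _ _ _ _).
  by move=> y; apply: kcov_valP; rewrite linearB /= sK subrr.
exists r => y; apply: val_inj; rewrite -[LHS]/(kcov_val i _) rE /=.
by rewrite kcov_val0 linear0 subr0.
Qed.

Lemma kcov_projective i : projective (kcov i).
Proof.
have [r rK] := kcov_retract i.
exact: retract_projective rK (@freeg_projective _ _).
Qed.

Lemma kcov_extend X i (f : {linear kcov i -> X}) :
  exists f' : {linear resol B i -> X}, forall y, f' (kcov_val i y) = f y.
Proof.
have [r rK] := kcov_retract i.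
by exists (f \o r) => y /=; rewrite rK.
Qed.

End KernelResolution.

End Resolutions.

(** * Ext through maps out of the syzygies *)

Section ExtClasses.
Variables (R : comNzRingType) (X : lmodType R).
Implicit Types A B C : lmodType R.

Lemma aug_coboundaryP A i (f : {linear syz A i -> X}) :
  ((f \o aug (syz A i) : {linear resol A i -> X}) : cochain A X i)
    \in coboundaries A X i <-> bounds (P := resolution A) f.
Proof.
case: i f => [|j] f /=; split.
- move=> /asboolP[x f0] z; have [y <-] := aug_surj z.
  exact: (congr1 (fun h : {linear _ -> _} => h y) f0).
- by move=> f0; apply/asboolP; exists 0; apply/linear_ext => y; apply: f0.
- move=> /asboolP[g gE]; exists g => z; have [y <-] := aug_surj z.
  exact: (congr1 (fun h : {linear _ -> _} => h y) gE).
- by case=> g gE; apply/asboolP; exists g; apply/linear_ext => y; apply: gE.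
Qed.

Section ExtClass.
Variables (A : lmodType R) (i : nat).
Implicit Type f : {linear syz A i -> X}.

Lemma ext_class_subproof f :
  ((f \o aug (syz A i) : {linear resol A i -> X}) : cochain A X i)
    \in submod_pred (ker_lin (cobound A X i)).
Proof.
apply/eqP/linear_ext => z /=; rewrite -[RHS](linear0 f); congr (f _).
by apply/syz_exact; eexists.
Qed.

(** Every cocycle of Hom(resol A, X) factors through the augmentation onto the
    syzygy, so that these classes exhaust Ext. *)
Definition ext_class f : Ext i A X :=
  quotmod_pi (@cocycle_coboundaries R A X i) (Submod (ext_class_subproof f)).

Lemma ext_class_linear : linear ext_class.
Proof.
move=> c f g; rewrite /ext_class -linearP; congr quotmod_pi.
by apply/val_inj/linear_ext.
Qed.
HB.instance Definition _ :=
  GRing.isLinear.Build R {linear syz A i -> X} (Ext i A X) _ ext_class ext_class_linear.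

Lemma ext_class_surj : surjection ext_class.
Proof.
move=> e; rewrite -[e]quotmod_reprK; case: (quotmod_repr e) => /= f f_cocycle.
have fd0 z : f (resol_d A i z) = 0.
  have /eqP f0 : f \in ker_lin (cobound A X i) := f_cocycle.
  exact: (congr1 (fun h : {linear _ -> _} => h z) f0).
have [|g gE] := @factor_surj R _ _ _ (aug (syz A i)) f (@aug_surj R (syz A i)).
  by move=> y /resol_exact[z <-].
by exists g; congr quotmod_pi; apply/val_inj/linear_ext.
Qed.

Lemma ext_class0P f : ext_class f = 0 <-> bounds (P := resolution A) f.
Proof.
rewrite -[0](linear0 (quotmod_pi _)) -aug_coboundaryP.
by split=> [/quotmod_piE|f_bound]; [|apply/quotmod_piE]; rewrite subr0.
Qed.

Lemma ext_class_eq f (g : {linear syz A i -> X}) : f =1 g -> ext_class f = ext_class g.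
Proof. by move=> /linear_ext->. Qed.

End ExtClass.

Lemma Ext_map_class A B (h : {linear A -> B}) i (f : {linear syz B i -> X}) :
  Ext_map X h i (ext_class f) = ext_class (f \o syz_map h i).
Proof.
rewrite /Ext_map /= quotmod_map_pi; congr quotmod_pi; apply/val_inj/linear_ext => y.
by rewrite /= aug_free_map.
Qed.

Lemma Ext_map_comp A B C (g : {linear B -> C}) (h : {linear A -> B}) i e :
  Ext_map X (g \o h) i e = Ext_map X h i (Ext_map X g i e).
Proof.
have [f <-] := ext_class_surj e; rewrite !Ext_map_class; apply: ext_class_eq => z.
by rewrite /= syz_map_comp.
Qed.

Lemma eq_Ext_map A B (g h : {linear A -> B}) i e :
  g =1 h -> Ext_map X g i e = Ext_map X h i e.
Proof. by move=> /linear_ext->. Qed.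

Lemma Ext_map_id A (h : {linear A -> A}) i e : h =1 id -> Ext_map X h i e = e.
Proof.
move=> h_id; rewrite (@eq_Ext_map _ _ h idfun) //.
have [f <-] := ext_class_surj e; rewrite Ext_map_class; apply: ext_class_eq => z.
by rewrite /= syz_map_id.
Qed.

Lemma resolution_projective A i : projective (tcov (resolution A) i).
Proof. exact: freeg_projective. Qed.

Lemma scale_map_proj A B (h : {linear A -> B}) (c : R) i y :
  aug (syz B i) ((resol_map (c \*: h) i \- c \*: resol_map h i) y) =
  (syz_map (c \*: h) i \- c \*: syz_map h i) (aug (syz A i) y).
Proof. by rewrite /= linearB linearZ /= !syz_map_proj. Qed.

Lemma scale_map_inc A B (h : {linear A -> B}) (c : R) i z :
  syz_inc B i ((syz_map (c \*: h) i.+1 \- c \*: syz_map h i.+1) z) =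
  (resol_map (c \*: h) i \- c \*: resol_map h i) (syz_inc A i z).
Proof. by []. Qed.

(** The functor of canonical resolutions is not additive, since [free_map \0] sends
    << x >> to << 0 >>.  Yet the resolution of c h and c times that of h lift the
    same map, so they agree in cohomology. *)
Lemma Ext_map_scale A B (h : {linear A -> B}) (c : R) i e :
  Ext_map X (c \*: h) i e = c *: Ext_map X h i e.
Proof.
have [f <-] := ext_class_surj e; apply/eqP; rewrite -subr_eq0; apply/eqP.
pose w := @TowerMap _ (resolution A) (resolution B) _ _
  (scale_map_proj h c) (scale_map_inc h c).
have <- : ext_class (f \o msyz w i : {linear syz A i -> X}) = 0.
  apply/ext_class0P; apply: (@tower_map_null R (resolution A) (resolution B) w).
    exact: resolution_projective.
  by move=> z; rewrite /= subrr.
rewrite !Ext_map_class -linearZ -linearB; apply: ext_class_eq => z.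
rewrite /= linearB; congr (_ - _).
by rewrite linearZ.
Qed.

End ExtClasses.

(** * The long exact sequence of Ext *)

Section ExtSequence.
Variables (R : comNzRingType) (X : lmodType R).
Implicit Types A B C : lmodType R.

Section Difference.
Variables (A B C : lmodType R) (f : {linear A -> B}) (g : {linear B -> C}).
Hypothesis gf0 : forall x, g (f x) = 0.

(** Although g \o f = 0, the map of resolutions induced by f does not land in the
    kernel of the one induced by g, which sends << f x >> to << 0 >> and not to 0.
    Subtracting the map of resolutions induced by \0 repairs this, and the
    result still lifts f. *)
Definition syz_diff i : {linear syz A i -> syz B i} :=
  syz_map f i \- syz_map (\0 : {linear A -> B}) i.
Definition resol_diff i : {linear resol A i -> resol B i} :=
  resol_map f i \- resol_map (\0 : {linear A -> B}) i.

Lemma gf_zero : g \o f = g \o (\0 : {linear A -> B}) :> {linear A -> C}.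
Proof. by apply/linear_ext => x /=; rewrite gf0 linear0. Qed.

Lemma syz_diff_ker i z : syz_map g i (syz_diff i z) = 0.
Proof. by rewrite linearB -!syz_map_comp gf_zero subrr. Qed.

Lemma resol_diff_ker i y : resol_map g i (resol_diff i y) = 0.
Proof. by rewrite linearB -!resol_map_comp gf_zero subrr. Qed.

Lemma syz_diff_proj i y : aug (syz B i) (resol_diff i y) = syz_diff i (aug (syz A i) y).
Proof. by rewrite linearB !syz_map_proj. Qed.

Lemma syz_diff_inc i z : syz_inc B i (syz_diff i.+1 z) = resol_diff i (syz_inc A i z).
Proof. by rewrite linearB !syz_map_inc. Qed.

Definition ksyz_diff i : {linear syz A i -> ksyz g i} := kernel_lift (@syz_diff_ker i).
Definition kcov_diff i : {linear resol A i -> kcov g i} := kernel_lift (@resol_diff_ker i).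

Lemma ksyz_val_diff i z : ksyz_val g i (ksyz_diff i z) = syz_diff i z.
Proof. by []. Qed.

Lemma kcov_val_diff i y : kcov_val g i (kcov_diff i y) = resol_diff i y.
Proof. by []. Qed.

Lemma ksyz_diff_proj i y : kproj g i (kcov_diff i y) = ksyz_diff i (aug (syz A i) y).
Proof. by apply: val_inj; apply: syz_diff_proj. Qed.

Lemma ksyz_diff_inc i z : kinc g i (ksyz_diff i.+1 z) = kcov_diff i (syz_inc A i z).
Proof.
apply: val_inj; rewrite -[LHS]/(kcov_val g i _) -[RHS]/(kcov_val g i _).
by rewrite kcov_val_inc ksyz_val_diff syz_diff_inc kcov_val_diff.
Qed.

Definition difference_map : tower_map (resolution A) (kernel_resolution g) :=
  @TowerMap _ (resolution A) (kernel_resolution g) _ _ ksyz_diff_proj ksyz_diff_inc.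
End Difference.

Definition tower_id (P : tower R) : tower_map P P :=
  @TowerMap _ P P (fun i => idfun) (fun i => idfun) (fun _ _ => erefl) (fun _ _ => erefl).

Section ShortExact.
Variables (A B C : lmodType R) (f : {linear A -> B}) (g : {linear B -> C}).
Hypothesis fg : short_exact f g.

Let gf0 := short_exact0 fg.
Let f_inj : injective f. Proof. by case: fg. Qed.
Let g_surj : surjection g. Proof. by case: fg. Qed.

(** The canonical resolution of A and the kernel resolution of g resolve the same
    module and the latter is projective, so the difference map is injective in
    cohomology. *)
Lemma kernel_bounds i (k : {linear ksyz g i -> X}) :
  bounds (P := resolution A) (k \o ksyz_diff gf0 i) ->
  bounds (P := kernel_resolution g) k.
Proof.
move=> k_bounds.
have [|v0 v0E] := factor_inj (q := ksyz_val g 0) f_inj.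
  by move=> z; have [_ _ <-] := fg; exact: (@ksyz_val0 _ _ _ g 0 z).
have v0_id z : msyz (tower_id (kernel_resolution g)) 0 z = ksyz_diff gf0 0 (v0 z).
  by apply: val_inj; rewrite /= v0E subr0.
have := @tower_comparison R _ (resolution A) _ (difference_map gf0)
  (tower_id (kernel_resolution g)) v0 (kcov_projective g_surj) v0_id X i k k_bounds.
by congr bounds; apply/linear_ext.
Qed.

Lemma Ext_map0 i e : Ext_map X (\0 : {linear A -> B}) i e = 0.
Proof.
have -> : \0 = 0 \*: (\0 : {linear A -> B}) :> {linear A -> B}.
  by apply/linear_ext => x /=; rewrite scale0r.
by rewrite Ext_map_scale scale0r.
Qed.

(** A cocycle h on B that is trivial on A is bounded on the kernel resolution; after
    extending a bounding map to the resolution of B, h may be taken zero on the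
    kernel resolution, and then it factors through the resolution of C. *)
Lemma Ext_exact i e : Ext_map X f i e = 0 -> exists c, e = Ext_map X g i c.
Proof.
move=> fe0; have [h hE] := ext_class_surj e; rewrite -hE in fe0 *.
have h_diff : bounds (P := resolution A) ((h \o ksyz_val g i) \o ksyz_diff gf0 i).
  apply/ext_class0P; rewrite -{}fe0 -[RHS]subr0 -[in RHS](Ext_map0 (ext_class h)).
  rewrite !Ext_map_class -linearB; apply: ext_class_eq => z /=.
  exact: linearB.
(* h' is h minus a coboundary, so it has the same class. *)
suff [h' h'E h'_ker] : exists2 h' : {linear syz B i -> X},
    ext_class h = ext_class h' & forall z, h' (ksyz_val g i z) = 0.
  have [|c cE] := factor_surj (q := h') (@syz_map_surj _ _ _ _ g_surj i).
    by move=> y /ksyz_valP[z <-].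
  exists (ext_class c); rewrite h'E Ext_map_class.
  by apply: ext_class_eq => z; rewrite /= cE.
move: (kernel_bounds h_diff) => {fe0 h_diff}; case: i e h {hE} => [|j] _ h /=.
  by exists h.
case=> k kE; have [k' k'E] := kcov_extend g_surj k.
exists (h - precomp (syz_inc B j) k'); last first.
  move=> z; rewrite -[LHS]/(h (ksyz_val g j.+1 z) - k' (syz_inc B j (ksyz_val g j.+1 z))).
  by rewrite -kcov_val_inc k'E -kE subrr.
have k'0 : ext_class (precomp (syz_inc B j) k' : {linear syz B j.+1 -> X}) = 0.
  by apply/ext_class0P; exists k'.
by rewrite linearB [X in _ - X]k'0 subr0.
Qed.

(** The graph of the connecting homomorphism Ext^i(A, X) -> Ext^{i+1}(C, X), by the
    usual zigzag: the cochain h on B restricts to the cocycle k on A, and its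
    coboundary comes from the cocycle l on C.  A relation suffices for the sequel,
    and naturality is immediate for it. *)
Definition connected i (e : Ext i A X) (c : Ext i.+1 C X) :=
  exists (k : {linear syz A i -> X}) (l : {linear syz C i.+1 -> X})
         (h : {linear resol B i -> X}),
    [/\ e = ext_class k, c = ext_class l,
        forall y, h (resol_diff f i y) = k (aug (syz A i) y)
      & forall z, h (syz_inc B i z) = l (syz_map g i.+1 z)].

Lemma connected_linear i (s : R) e1 c1 e2 c2 :
  @connected i e1 c1 -> @connected i e2 c2 ->
  @connected i (s *: e1 + e2) (s *: c1 + c2).
Proof.
move=> [k1 [l1 [h1 [-> -> hk1 hl1]]]] [k2 [l2 [h2 [-> -> hk2 hl2]]]].
exists (s *: k1 + k2), (s *: l1 + l2), (s *: h1 + h2).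
split; [exact/esym/linearP | exact/esym/linearP | move=> y | move=> z].
- by rewrite -[RHS]/(s *: k1 _ + k2 _) -hk1 -hk2.
- by rewrite -[RHS]/(s *: l1 _ + l2 _) -hl1 -hl2.
Qed.

Lemma connected_total i c : Ext_map X g i.+1 c = 0 -> exists e, @connected i e c.
Proof.
have [l <-] := ext_class_surj c; rewrite Ext_map_class => /ext_class0P[h hE].
have [|k kE] := factor_surj (q := h \o kcov_val g i) (@kproj_surj _ _ _ g i).
  move=> y /kernel_exact[z <-].
  rewrite -[LHS]/(h (kcov_val g i (kinc g i z))) kcov_val_inc.
  by rewrite -[LHS]hE -[LHS]/(l (syz_map g i.+1 _)) ksyz_val0 linear0.
exists (ext_class (k \o ksyz_diff gf0 i)), (k \o ksyz_diff gf0 i), l, h.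
split=> // [y|z]; last exact/esym/hE.
by rewrite -[RHS]/(k (ksyz_diff gf0 i (aug (syz A i) y))) -ksyz_diff_proj kE.
Qed.

Lemma connected_functional i c : @connected i 0 c -> c = 0.
Proof.
case=> e [l [h [/esym e0 -> hk hl]]]; apply/ext_class0P.
have [|k kE] := factor_surj (q := h \o kcov_val g i) (@kproj_surj _ _ _ g i).
  move=> y /kernel_exact[z <-].
  rewrite -[LHS]/(h (kcov_val g i (kinc g i z))) kcov_val_inc.
  by rewrite hl ksyz_val0 linear0.
have /kernel_bounds k_bounds : bounds (P := resolution A) (k \o ksyz_diff gf0 i).
  rewrite (_ : (k \o ksyz_diff gf0 i : {linear _ -> _}) = e); first exact/ext_class0P.
  apply/linear_ext => z; have [y <-] := aug_surj z.
  rewrite -hk -[LHS]/(k (ksyz_diff gf0 i (aug (syz A i) y))) -ksyz_diff_proj kE.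
  by rewrite -[LHS]/(h (kcov_val g i _)) kcov_val_diff.
(* Correcting h by a cocycle on B does not affect its coboundary. *)
suff [h' h'_inc h'_ker] : exists2 h' : {linear resol B i -> X},
    forall z, h' (syz_inc B i z) = h (syz_inc B i z)
    & forall y, h' (kcov_val g i y) = 0.
  have [||m mE] := factor_surj (p := resol_map g i) (q := h').
  - by move=> y; have [s sK] := resol_map_section i g_surj; exists (s y).
  - by move=> y /kcov_valP[z <-].
  exists m => z; have [y <-] := @syz_map_surj _ _ _ _ g_surj i.+1 z.
  rewrite -hl -h'_inc -mE; congr (m _); exact: syz_map_inc.
have kE' y : k (kproj g i y) = h (kcov_val g i y) by rewrite kE.
move: h k {c e l e0 hk hl kE} kE' k_bounds => h k; case: i h k => [|j] h k kE.
  by move=> k0; exists h => // y; rewrite -kE.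
case=> m mE; have [m' m'E] := kcov_extend g_surj m.
exists (h \- ((m' \o syz_inc B j) \o aug (syz B j.+1))) => [z|y].
  rewrite -[LHS]/(h _ - m' (syz_inc B j (aug (syz B j.+1) (syz_inc B j.+1 z)))).
  by rewrite [aug _ _](@tproj_inc _ (resolution B) j.+1 z) linear0 subr0.
rewrite -[LHS]/(h _ - m' (syz_inc B j (aug (syz B j.+1) (kcov_val g j.+1 y)))).
by rewrite -ksyz_val_proj -kcov_val_inc m'E -mE kE subrr.
Qed.

End ShortExact.
End ExtSequence.

Section ConnectedMap.
Variables (R : comNzRingType) (X : lmodType R).
Variables (A1 B1 C1 A2 B2 C2 : lmodType R).
Variables (f1 : {linear A1 -> B1}) (g1 : {linear B1 -> C1}).
Variables (f2 : {linear A2 -> B2}) (g2 : {linear B2 -> C2}).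
Variables (u : {linear A1 -> A2}) (v : {linear B1 -> B2}) (w : {linear C1 -> C2}).
Hypotheses (vf : forall x, v (f1 x) = f2 (u x)) (wg : forall y, w (g1 y) = g2 (v y)).

Lemma connected_map i (e : Ext i A2 X) (c : Ext i.+1 C2 X) :
  connected f2 g2 e c -> connected f1 g1 (Ext_map X u i e) (Ext_map X w i.+1 c).
Proof.
move=> [k [l [h [-> -> hk hl]]]].
have vfE : v \o f1 = f2 \o u :> {linear A1 -> B2} by apply/linear_ext.
have wgE : w \o g1 = g2 \o v :> {linear B1 -> C2} by apply/linear_ext.
have v0E : v \o \0 = \0 \o u :> {linear A1 -> B2}.
  by apply/linear_ext => x /=; rewrite linear0.
exists (k \o syz_map u i), (l \o syz_map w i.+1), (h \o resol_map v i).
split; [exact: Ext_map_class | exact: Ext_map_class | move=> y | move=> z].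
  rewrite -[LHS]/(h (resol_map v i (resol_diff f1 i y))).
  rewrite -[RHS]/(k (syz_map u i (aug (syz A1 i) y))) -syz_map_proj -hk.
  congr (h _); rewrite -[resol_diff f1 i y]/(resol_map f1 i y - resol_map _ i y).
  rewrite -[RHS]/(resol_map f2 i _ - resol_map _ i _).
  by rewrite linearB -!resol_map_comp vfE v0E.
rewrite -[LHS]/(h (resol_map v i (syz_inc B1 i z))) -syz_map_inc hl.
rewrite -[RHS]/(l (syz_map w i.+1 (syz_map g1 i.+1 z))).
by rewrite -!syz_map_comp wgE.
Qed.

End ConnectedMap.

(** * Noetherian modules *)

Section Noetherian.
Variable R : comNzRingType.
Implicit Types (M N V W : lmodType R).

Definition submod_of V (P : {pred V}) (P_closed : GRing.submod_closed P) :
  submodClosed V := HB.pack P (GRing.isSubmodClosed.Build R V P P_closed).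

Lemma submodB V (S : submodClosed V) x y : x \in S -> y \in S -> x - y \in S.
Proof. by move=> xS yS; rewrite -scaleN1r rpredD ?rpredZ. Qed.

Lemma span_in V (G : {pred V}) x : x \in G -> x \in span G.
Proof. by move=> xG; apply/asboolP => S; apply. Qed.

Lemma span_sub V (G : {pred V}) (S : submodClosed V) :
  {subset G <= S} -> {subset span G <= S}.
Proof. by move=> GS x /asboolP; apply. Qed.

Lemma span_nil V x : x \in span [in [::] : seq V] -> x = 0.
Proof.
have cl : GRing.submod_closed (pred1 (0 : V)).
  split=> [|c y z]; rewrite !inE // => /eqP-> /eqP->.
  by rewrite scaler0 addr0.
by move=> /(@span_sub _ _ (submod_of cl)) xP; apply/eqP/xP.
Qed.

Lemma span_cons V (x : V) s y : y \in span [in x :: s] ->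
  exists c z, z \in span [in s] /\ y = c *: x + z.
Proof.
pose P : {pred V} :=
  [pred y | `[< exists c z, z \in span [in s] /\ y = c *: x + z >]].
have P_closed : GRing.submod_closed P.
  split; first by apply/asboolP; exists 0, 0; rewrite scale0r addr0 rpred0.
  move=> c _ _ /asboolP[d1 [z1 [z1s ->]]] /asboolP[d2 [z2 [z2s ->]]].
  apply/asboolP; exists (c * d1 + d2), (c *: z1 + z2).
  rewrite rpredD ?rpredZ //; split=> //.
  by rewrite scalerDr scalerA scalerDl addrACA.
move=> /(@span_sub _ _ (submod_of P_closed)) yP; apply/asboolP/yP => z.
rewrite inE => /predU1P[->|zs]; apply/asboolP.
  by exists 1, 0; rewrite scale1r addr0 rpred0.
by exists 0, z; rewrite scale0r add0r span_in.
Qed.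

Definition noetherian_module V := forall N : submodClosed V, fg_submod N.

Section LeadingCoefficients.
Variables (V : lmodType R) (x : V) (s : seq V) (N : submodClosed V).

(** The analogue of the ideal of leading coefficients in the proof of the basis
    theorem: it controls the elements of N modulo span s. *)
Definition leading : {pred R^o} :=
  [pred c : R^o | `[< exists2 z, z \in span [in s] & (c : R) *: x + z \in N >]].

Lemma leading_closed : GRing.submod_closed leading.
Proof.
split; first by apply/asboolP; exists 0; rewrite ?rpred0 // scale0r addr0 rpred0.
move=> c d1 d2 /asboolP[z1 z1s N1] /asboolP[z2 z2s N2]; apply/asboolP.
exists (c *: z1 + z2); first by rewrite rpredD ?rpredZ.
have -> : (c *: d1 + d2 : R) *: x + (c *: z1 + z2) =
          c *: ((d1 : R) *: x + z1) + ((d2 : R) *: x + z2).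
  by rewrite scalerDr scalerA scalerDl addrACA.
by rewrite rpredD ?rpredZ.
Qed.
End LeadingCoefficients.

(** By induction on s: generators of the part of N in span s, together with one
    element of N for each generator of the ideal [leading x s N], generate N. *)
Lemma noetherian_span V (s : seq V) (N : submodClosed V) :
  noetherian R -> {subset N <= span [in s]} -> fg_submod N.
Proof.
move=> R_noeth; elim: s N => [|x s IHs] N Ns.
  exists [::] => y; apply/idP/idP => [/Ns//|/span_nil->].
  exact: rpred0.
pose J : {pred V} := [pred y | (y \in N) && (y \in span [in s])].
have J_closed : GRing.submod_closed J.
  split=> [|c y z /andP[yN ys] /andP[zN zs]]; apply/andP; first by rewrite !rpred0.
  by split; rewrite rpredD ?rpredZ.
have [t tE] : fg_submod (submod_of J_closed) by apply: IHs => y /andP[].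
have [r rE] := R_noeth (submod_of (leading_closed x s N)).
have /choice[y yP] : forall c : R^o, exists y, c \in r ->
    y \in N /\ exists2 z, z \in span [in s] & y = (c : R) *: x + z.
  move=> c; have [cr|_] := boolP (c \in r); last by exists 0.
  have /asboolP[z zs zN] : c \in submod_of (leading_closed x s N).
    by rewrite rE span_in.
  by exists ((c : R) *: x + z) => _; split=> //; exists z.
pose T := span [in map y r ++ t].
have TN : {subset T <= N}.
  apply: span_sub => v; rewrite mem_cat => /orP[/mapP[c cr ->]|vt].
    by have [] := yP c cr.
  have : v \in submod_of J_closed by rewrite tE span_in.
  by case/andP.
exists (map y r ++ t) => w; apply/idP/idP; last exact: TN.
rewrite -/T => wN.
have [c [z [zs wE]]] := span_cons (Ns w wN).
have /asboolP[z' z's z'T] : (c : R^o) \in leading x s T.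
  have : (c : R^o) \in submod_of (leading_closed x s N).
    by apply/asboolP; exists z; rewrite -?wE.
  rewrite rE; move: (c : R^o); apply: (@span_sub _ _ (submod_of (leading_closed x s T))).
  move=> d dr; have [dN [v vs dE]] := yP d dr; apply/asboolP; exists v => //.
  by rewrite -dE span_in // mem_cat map_f.
have -> : w = (c *: x + z') + (z - z') by rewrite addrACA subrr addr0 wE.
rewrite rpredD //.
have : z - z' \in submod_of J_closed.
  have zz'E : z - z' = w - (c *: x + z') by rewrite wE opprD addrACA subrr add0r.
  apply/andP; split.
    by rewrite zz'E submodB // TN.
  exact: submodB.
by rewrite tE; apply: span_sub => v vt; rewrite span_in // mem_cat vt orbT.
Qed.

Lemma fg_noetherian V : noetherian R -> fg_module V -> noetherian_module V.
Proof.
by move=> R_noeth [s sE] N; apply: (@noetherian_span _ s) => // x _; rewrite -sE.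
Qed.

End Noetherian.

(** * The Artin-Rees property *)

Section ArtinRees.
Variable R : comNzRingType.
Implicit Types (V : lmodType R) (a : submodClosed R^o).

Section Chains.
Variables (V : lmodType R) (V_noeth : noetherian_module V).

Lemma ascending_stationary (N : nat -> submodClosed V) :
    (forall k, {subset N k <= N k.+1}) ->
  exists K, forall k, {subset N k <= N K}.
Proof.
move=> NS.
have Nle j k : (j <= k)%N -> {subset N j <= N k}.
  elim: k => [|k IHk]; first by rewrite leqn0 => /eqP->.
  rewrite leq_eqVlt => /predU1P[->//|jk] x xN; exact/NS/(IHk jk).
pose U : {pred V} := [pred x | `[< exists k, x \in N k >]].
have U_closed : GRing.submod_closed U.
  split=> [|c x y /asboolP[j xj] /asboolP[k yk]]; apply/asboolP.
    by exists 0%N; apply: rpred0.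
  exists (maxn j k); rewrite rpredD ?rpredZ //.
    by apply: Nle xj; apply: leq_maxl.
  by apply: Nle yk; apply: leq_maxr.
have [s sE] := V_noeth (submod_of U_closed).
suff [K sK] : exists K, {subset s <= N K}.
  exists K => k x xk; have : x \in submod_of U_closed by apply/asboolP; exists k.
  by rewrite sE; apply: span_sub.
have : {subset s <= U}.
  by move=> x xs; have : x \in submod_of U_closed by rewrite sE span_in.
elim: s {sE} => [|x s IHs] sU; first by exists 0%N.
have [y ys|K sK] := IHs; first by apply: sU; rewrite inE ys orbT.
have /asboolP[k xk] := sU x (mem_head x s).
exists (maxn K k) => y; rewrite inE => /predU1P[->|ys].
  by apply: Nle xk; apply: leq_maxr.
by apply: Nle (sK y ys); apply: leq_maxl.
Qed.

(** Otherwise choose a strictly larger member of F above each member of F: iterating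
    gives a chain that never becomes stationary. *)
Lemma noetherian_maximal (F : submodClosed V -> Prop) (N0 : submodClosed V) : F N0 ->
  exists2 N, F N & forall N', F N' -> {subset N <= N'} -> {subset N' <= N}.
Proof.
move=> FN0; apply: contrapT => noMax.
have /choice[next nextP] : forall N : {N | F N}, exists N' : {N | F N},
    {subset sval N <= sval N'} /\ ~ {subset sval N' <= sval N}.
  case=> N FN /=; apply: contrapT => noNext; apply: noMax; exists N => // N' FN' NN'.
  by apply: contrapT => N'N; apply: noNext; exists (exist F N' FN').
pose N k := iter k next (exist F N0 FN0).
have [K NK] := @ascending_stationary (fun k => sval (N k)) (fun k => (nextP (N k)).1).
exact: (nextP (N K)).2 (NK K.+1).
Qed.
End Chains.

Section Scalars.
Variables (V : lmodType R) (W : submodClosed V) (p : V).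

Definition scalars_into : {pred R^o} := [pred c : R^o | (c : R) *: p \in W].
Lemma scalars_into_closed : GRing.submod_closed scalars_into.
Proof.
split=> [|c d d']; rewrite !inE ?scale0r ?rpred0 // => dW d'W.
by rewrite scalerDl -scalerA rpredD // rpredZ.
Qed.
HB.instance Definition _ :=
  GRing.isSubmodClosed.Build R R^o scalars_into scalars_into_closed.
End Scalars.

Section Colon.
Variables (V : lmodType R) (W : submodClosed V) (x : R).

Definition colon : {pred V} := [pred p | x *: p \in W].
Lemma colon_closed : GRing.submod_closed colon.
Proof.
split=> [|c p q]; rewrite !inE ?scaler0 ?rpred0 // => pW qW.
by rewrite scalerDr scalerA mulrC -scalerA rpredD // rpredZ.
Qed.
HB.instance Definition _ := GRing.isSubmodClosed.Build R V colon colon_closed.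

Definition add_multiples : {pred V} :=
  [pred v | `[< exists2 w, w \in W & exists p, v = w + x *: p >]].
Lemma add_multiples_closed : GRing.submod_closed add_multiples.
Proof.
split=> [|c u v /asboolP[w wW [p ->]] /asboolP[w' w'W [p' ->]]]; apply/asboolP.
  by exists 0; rewrite ?rpred0 //; exists 0; rewrite scaler0 addr0.
exists (c *: w + w'); first by rewrite rpredD ?rpredZ.
by exists (c *: p + p'); rewrite !scalerDr !scalerA [x * c]mulrC addrACA.
Qed.
HB.instance Definition _ :=
  GRing.isSubmodClosed.Build R V add_multiples add_multiples_closed.

Lemma sub_colon : {subset W <= colon}.
Proof. by move=> w wW; rewrite inE rpredZ. Qed.

Lemma sub_add_multiples : {subset W <= add_multiples}.
Proof. by move=> w wW; apply/asboolP; exists w => //; exists 0; rewrite scaler0 addr0. Qed.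

Lemma multiple_add_multiples p : x *: p \in add_multiples.
Proof. by apply/asboolP; exists 0; rewrite ?rpred0 //; exists p; rewrite add0r. Qed.
End Colon.

(** This says that a^(k + l) is contained in the product of a^k and a^l, in the form
    that fits induction: peel one factor x off a^k and replace W by its colon. *)
Lemma idealX_mul_sub a V (W : submodClosed V) k l :
    (forall c d p, c \in idealX a k -> d \in idealX a l -> (c : R) *: ((d : R) *: p) \in W) ->
  forall c p, c \in idealX a (k + l) -> (c : R) *: p \in W.
Proof.
elim: k W => [|k IHk] W kl.
  by move=> c p cl; rewrite -[X in X \in _]scale1r; apply: (kl 1).
move=> c p; move: c.
apply: (@span_sub _ _ _ (scalars_into W p)) => _ /asboolP[x [d [xa dkl ->]]].
rewrite inE -scalerA.
apply: (IHk (colon W x) _ d p dkl) => c e q ck el; rewrite inE scalerA.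
by apply: kl => //; apply: span_in; apply/asboolP; exists x, c.
Qed.

Lemma power_idealX a (x : R) k : (x : R^o) \in a -> (x ^+ k : R^o) \in idealX a k.
Proof.
move=> xa; elim: k => [//|k IHk]; apply: span_in; apply/asboolP.
by exists x, (x ^+ k); rewrite exprS.
Qed.

(** If each of finitely many generators of a has a power that maps V into W, then so
    does a.  Rather than counting monomials, decrease the exponent j of one generator
    x at a time: some a^m V is contained in W + x V, where x no longer matters, and
    some a^l V in the colon of W by x, for which the exponent of x is smaller;
    therefore a^(l + m) V is contained in W. *)
Lemma idealX_absorbs a (s : seq R^o) V (W : submodClosed V) :
    a =i span [in s] ->
    {in s, forall x : R, exists j, forall p, x ^+ j *: p \in W} ->
  exists m, forall c p, c \in idealX a m -> (c : R) *: p \in W.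
Proof.
move=> aE; pose absorbed (U : submodClosed V) :=
  exists m, forall c p, c \in idealX a m -> (c : R) *: p \in U.
suff main (t : seq R^o) (U : submodClosed V) :
    {in s, forall x : R, x \in t \/ forall p, x *: p \in U} ->
    {in t, forall x : R, exists j, forall p, x ^+ j *: p \in U} -> absorbed U.
  by move=> sW; apply: (main s W) => // x xs; left.
elim: t U => [|x t IHt] U sU tU.
  exists 1%N => c p; move: c; apply: (@span_sub _ _ _ (scalars_into U p)).
  move=> _ /asboolP[x [d [xa _ ->]]]; rewrite inE -scalerA.
  move: xa; rewrite aE; apply: (@span_sub _ _ _ (scalars_into U (d *: p))) => y.
  by case/sU=> // yU; rewrite inE.
have [j] := tU x (mem_head x t); elim: j U sU tU => [|j IHj] U sU tU xj.
  by exists 0%N => c p _; rewrite rpredZ // -[p]scale1r -(expr0 x).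
have [m mP] : absorbed (add_multiples U x).
  apply: IHt => y.
    move=> /sU[]; last by right => p; apply/sub_add_multiples.
    by rewrite inE => /predU1P[->|]; [right; apply: multiple_add_multiples | left].
  move=> yt; have [|i iP] := tU y; first by rewrite inE yt orbT.
  by exists i => p; apply/sub_add_multiples.
have [l lP] : absorbed (colon U x).
  apply: IHj => [y ys|y yt|p].
  - by have [|yV] := sU y ys; [left | right => p; apply/sub_colon].
  - by have [i iP] := tU y yt; exists i => p; apply/sub_colon.
  - by rewrite inE scalerA -exprS.
exists (l + m)%N; apply: idealX_mul_sub => c d p cl dm.
have /asboolP[w wV [q ->]] := mP d p dm.
rewrite scalerDr rpredD //; first exact: rpredZ.
rewrite scalerA mulrC -scalerA.
exact: lP.
Qed.

(** Used with A a submodule and D = a^l A: some a^m V meets A inside a^l A.  Take W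
    maximal among the submodules containing D and meeting A inside D.  For x in a,
    the colons of W by the powers of x are stationary from some j on; then
    W + x^j V still meets A inside D, so that x^j V is contained in W by
    maximality.  Hence a power of a maps V into W. *)
Lemma artin_rees a V (A D : submodClosed V) l :
    noetherian R -> noetherian_module V -> {subset D <= A} ->
    (forall c v, c \in idealX a l -> v \in A -> (c : R) *: v \in D) ->
  exists m, forall v, v \in prodmod (idealX a m) (predT : {pred V}) -> v \in A -> v \in D.
Proof.
move=> R_noeth V_noeth DA lAD.
pose small (W : submodClosed V) :=
  {subset D <= W} /\ forall v, v \in W -> v \in A -> v \in D.
have [|W [DW WAD] W_max] := @noetherian_maximal V V_noeth small D; first by split.
have [s sE] := R_noeth a.
have [x xs|m mP] := @idealX_absorbs a s V W sE.
  have xa : (x : R^o) \in a by rewrite sE span_in.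
  have [|j jP] := @ascending_stationary V V_noeth (fun j => colon W (x ^+ j)).
    by move=> j p; rewrite !inE exprS -scalerA => /rpredZ.
  exists j => p; apply: W_max (multiple_add_multiples W (x ^+ j) p).
    split=> [v /DW|_ /asboolP[w wW [q ->]] wqA]; first exact: sub_add_multiples.
    apply: (WAD) => //; rewrite rpredD //.
    (* x^l maps w + x^j q into D, so x^(l+j) q is in W, hence so is x^j q. *)
    have := jP (l + j)%N q; rewrite !inE; apply.
    rewrite exprD -scalerA.
    have -> : x ^+ j *: q = (w + x ^+ j *: q) - w by rewrite addrC addKr.
    rewrite scalerBr; apply: submodB; last exact: rpredZ.
    apply: DW; apply: (lAD (x ^+ l : R^o)) => //.
    exact: power_idealX.
  exact: sub_add_multiples.
exists m => v vm; apply: WAD; move: v vm; apply: span_sub => _ /asboolP[c [p [cm _ ->]]].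
exact: mP.
Qed.

End ArtinRees.

(** * Adic quotients of a short exact sequence *)

Section ColimitMap.
Variables (R : comNzRingType) (E F : nat -> lmodType R).
Variables (d : forall k, {linear E k -> E k.+1}) (d' : forall k, {linear F k -> F k.+1}).
Variable h : forall k, {linear E k -> F k}.
Hypothesis hd : forall k x, h k.+1 (d k x) = d' k (h k x).

Definition seqprod_map (u : seqprod E) : seqprod F := fun k => h k (u k).

Lemma seqprod_map_linear : linear seqprod_map.
Proof. by move=> c u v; apply: functional_extensionality_dep => k; apply: linearP. Qed.
HB.instance Definition _ := GRing.isLinear.Build R (seqprod E) (seqprod F) _
  seqprod_map seqprod_map_linear.

Lemma seqprod_map_compatible :
  {homo seqprod_map : u / u \in compatible d >-> u \in compatible d'}.
Proof.
move=> u /asboolP[N uN]; apply/asboolP; exists N => k Nk.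
by rewrite /seqprod_map -hd uN.
Qed.

Definition compatible_map : {linear submod (compatible d) -> submod (compatible d')} :=
  submod_map seqprod_map_compatible.

Lemma compatible_map_evzero :
  {homo compatible_map : u / u \in evzero (f := d) >-> u \in evzero (f := d')}.
Proof.
move=> u /asboolP[N uN]; apply/asboolP; exists N => k Nk.
by rewrite /= /seqprod_map uN ?linear0.
Qed.

Definition colim_map : {linear colim d -> colim d'} :=
  quotmod_map compatible_map_evzero.

Lemma push_map k (x : E k) j : h j (push d x j) = push d' (h k x) j.
Proof.
elim: j => [|j IHj] /=; case: eqP => e; rewrite ?linear0 //.
- by case: _ / e.
- by case: _ / e.
- by rewrite hd IHj.
Qed.

Lemma colim_map_in k (x : E k) : colim_map (colim_in d x) = colim_in d' (h k x).
Proof.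
rewrite /colim_map /= /colim_in quotmod_map_pi; congr quotmod_pi; apply/val_inj.
by apply: functional_extensionality_dep => j; apply: push_map.
Qed.
End ColimitMap.

Section AdicQuotients.
Variables (R : comNzRingType) (a : submodClosed R^o).
Implicit Types (M N A B C : lmodType R).

Lemma idealX_le k l : (k <= l)%N -> {subset idealX a l <= idealX a k}.
Proof.
elim: l => [|l IHl]; first by rewrite leqn0 => /eqP->.
rewrite leq_eqVlt => /predU1P[->//|kl] x xl; exact/(IHl kl)/idealXS.
Qed.

Lemma prodmod_map M N (I : {pred R^o}) (h : {linear M -> N}) :
  {homo h : x / x \in prodmod I (predT : {pred M}) >-> x \in prodmod I (predT : {pred N})}.
Proof.
pose J : submodClosed N := prodmod I predT.
have J_closed : GRing.submod_closed [pred x | h x \in J].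
  split=> [|c x y xJ yJ]; first by rewrite inE linear0 rpred0.
  by rewrite inE linearP rpredD // rpredZ.
apply: (@span_sub _ _ _ (submod_of J_closed)) => _ /asboolP[c [x [cI _ ->]]].
rewrite -[_ \in _]/(h _ \in J) linearZ; apply: span_in; apply/asboolP.
by exists c, (h x).
Qed.

Lemma prodmod_lift M N (I : {pred R^o}) (h : {linear M -> N}) z : surjection h ->
    z \in prodmod I (predT : {pred N}) ->
  exists2 y, y \in prodmod I (predT : {pred M}) & h y = z.
Proof.
move=> h_surj.
pose P : {pred N} :=
  [pred z | `[< exists2 y, y \in prodmod I (predT : {pred M}) & h y = z >]].
have P_closed : GRing.submod_closed P.
  split=> [|c _ _ /asboolP[x xI <-] /asboolP[y yI <-]]; apply/asboolP.
    by exists 0; rewrite ?rpred0 ?linear0.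
  by exists (c *: x + y); rewrite ?linearP // rpredD // rpredZ.
move=> zI; apply/asboolP; move: z zI.
apply: (@span_sub _ _ _ (submod_of P_closed)) => _ /asboolP[c [x [cI _ ->]]].
have [y <-] := h_surj x; apply/asboolP; exists ((c : R) *: y); last exact: linearZ.
by apply: span_in; apply/asboolP; exists c, y.
Qed.

Definition adic_pi M k : {linear M -> quotX a M k} :=
  quotmod_pi (prodmod (idealX a k) (predT : {pred M})).

Lemma adic_pi_surj M k : surjection (adic_pi M k).
Proof. exact: quotmod_pi_surj. Qed.

Lemma adic_pi0P M k x : adic_pi M k x = 0 <-> x \in prodmod (idealX a k) (predT : {pred M}).
Proof. exact: quotmod_pi0P. Qed.

Definition adic_map M N (h : {linear M -> N}) k : {linear quotX a M k -> quotX a N k} :=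
  quotmod_map (@prodmod_map M N (idealX a k) h).

Lemma adic_map_pi M N (h : {linear M -> N}) k x : adic_map h k (adic_pi M k x) = adic_pi N k (h x).
Proof. exact: quotmod_map_pi. Qed.

Definition adic_proj M k l (kl : (k <= l)%N) : {linear quotX a M l -> quotX a M k} :=
  quotmod_map (h := idfun) (prodmodS (N := predT) (idealX_le kl)).

Lemma adic_proj_pi M k l (kl : (k <= l)%N) x : adic_proj M kl (adic_pi M l x) = adic_pi M k x.
Proof. exact: quotmod_map_pi. Qed.

Lemma quotX_proj_pi M k x : quotX_proj a M k (adic_pi M k.+1 x) = adic_pi M k x.
Proof. exact: quotmod_map_pi. Qed.

Lemma adic_proj_step M k l (kl : (k <= l)%N) (kl1 : (k <= l.+1)%N) u :
  adic_proj M kl (quotX_proj a M l u) = adic_proj M kl1 u.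
Proof. by have [x <-] := adic_pi_surj u; rewrite quotX_proj_pi !adic_proj_pi. Qed.

Lemma adic_proj_comp M k l m (kl : (k <= l)%N) (lm : (l <= m)%N) (km : (k <= m)%N) u :
  adic_proj M kl (adic_proj M lm u) = adic_proj M km u.
Proof. by have [x <-] := adic_pi_surj u; rewrite !adic_proj_pi. Qed.

Lemma adic_proj_id M k (kk : (k <= k)%N) : adic_proj M kk =1 id.
Proof. by move=> u; have [x <-] := adic_pi_surj u; rewrite adic_proj_pi. Qed.

Lemma adic_map_step M N (h : {linear M -> N}) k u :
  quotX_proj a N k (adic_map h k.+1 u) = adic_map h k (quotX_proj a M k u).
Proof.
have [x <-] := adic_pi_surj u; rewrite adic_map_pi quotX_proj_pi.
by rewrite quotX_proj_pi adic_map_pi.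
Qed.

Lemma adic_map_comp M N A (g : {linear N -> A}) (h : {linear M -> N}) k u :
  adic_map (g \o h) k u = adic_map g k (adic_map h k u).
Proof. by have [x <-] := adic_pi_surj u; rewrite 3!adic_map_pi. Qed.

Lemma adic_map_scale M N (h : {linear M -> N}) (c : R) k u :
  adic_map (c \*: h) k u = c *: adic_map h k u.
Proof.
have [x <-] := adic_pi_surj u; rewrite 2!adic_map_pi.
rewrite -[LHS]/(adic_pi N k (c *: h x)).
exact: linearZ.
Qed.

Lemma adic_proj_map M N (h : {linear M -> N}) k l (kl : (k <= l)%N) u :
  adic_proj N kl (adic_map h l u) = adic_map h k (adic_proj M kl u).
Proof. by have [x <-] := adic_pi_surj u; rewrite adic_map_pi !adic_proj_pi adic_map_pi. Qed.

Lemma adic_map_surj M N (h : {linear M -> N}) k : surjection h -> surjection (adic_map h k).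
Proof.
move=> h_surj u; have [y <-] := adic_pi_surj u; have [x <-] := h_surj y.
by exists (adic_pi M k x); rewrite adic_map_pi.
Qed.

Definition annihilated N := forall c x, c \in a -> (c : R) *: x = 0 :> N.

Section ShortExact.
Variables (A B C : lmodType R) (f : {linear A -> B}) (g : {linear B -> C}).
Hypothesis fg : short_exact f g.

Definition adic_ker k : lmodType R := submod (ker_lin (adic_map g k)).
Definition adic_ker_val k : {linear adic_ker k -> quotX a B k} :=
  (val : submod (ker_lin (adic_map g k)) -> _).

Lemma adic_ker_val0 k y : adic_map g k (adic_ker_val k y) = 0.
Proof. exact: ker_val0. Qed.

Lemma adic_ker_exact k : short_exact (adic_ker_val k) (adic_map g k).
Proof.
by apply: short_exact_ker; apply: adic_map_surj; case: fg.
Qed.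

Lemma adic_map_fg0 k u : adic_map g k (adic_map f k u) = 0.
Proof.
by have [x <-] := adic_pi_surj u; rewrite !adic_map_pi (short_exact0 fg) linear0.
Qed.

Definition adic_ker_in k : {linear quotX a A k -> adic_ker k} := kernel_lift (@adic_map_fg0 k).

Lemma adic_ker_proj_subproof k l (kl : (k <= l)%N) y :
  adic_map g k (adic_proj B kl (adic_ker_val l y)) = 0.
Proof. by rewrite -adic_proj_map adic_ker_val0 linear0. Qed.

Definition adic_ker_proj k l (kl : (k <= l)%N) : {linear adic_ker l -> adic_ker k} :=
  kernel_lift (q := adic_proj B kl \o adic_ker_val l) (adic_ker_proj_subproof kl).

(** The kernel of B / a^m B -> C / a^m C is A / (A n a^m B).  For m large, Artin-Rees
    puts A n a^m B inside a^l A, whence a map to A / a^l A; its composite with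
    A / a^l A -> B / a^l B is the evident one. *)
Lemma adic_ker_to_quotX l : noetherian R -> noetherian_module B ->
  exists m (lm : (l <= m)%N) (r : {linear adic_ker m -> quotX a A l}),
    forall y, adic_map f l (r y) = adic_proj B lm (adic_ker_val m y).
Proof.
move=> R_noeth B_noeth; have [f_inj g_surj gf] := fg.
pose D : {pred B} :=
  [pred y | `[< exists2 x, x \in prodmod (idealX a l) (predT : {pred A}) & f x = y >]].
have D_closed : GRing.submod_closed D.
  split=> [|c _ _ /asboolP[x xI <-] /asboolP[y yI <-]]; apply/asboolP.
    by exists 0; rewrite ?rpred0 ?linear0.
  by exists (c *: x + y); rewrite ?linearP // rpredD // rpredZ.
have [||m0 m0P] := @artin_rees R a B (im_lin f) (submod_of D_closed) l R_noeth B_noeth.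
- by move=> _ /asboolP[x _ <-]; apply/asboolP; exists x.
- move=> c _ cl /asboolP[x ->]; apply/asboolP; exists ((c : R) *: x); last exact: linearZ.
  by apply: span_in; apply/asboolP; exists c, x.
pose m := maxn l m0.
have lm : (l <= m)%N by apply: leq_maxl.
have p_surj : surjection (adic_ker_in m \o adic_pi A m).
  move=> y; have [b bE] := adic_pi_surj (adic_ker_val m y).
  have /adic_pi0P gb0 : adic_pi C m (g b) = 0 by rewrite -adic_map_pi bE adic_ker_val0.
  have [b' b'I gb'] := prodmod_lift g_surj gb0.
  have [x xE] : exists x, f x = b - b' by apply/gf; rewrite linearB gb' subrr.
  exists x; apply: val_inj; rewrite -[RHS]bE -[LHS]/(adic_map f m (adic_pi A m x)) adic_map_pi xE.
  by rewrite linearB (_ : adic_pi B m b' = 0) ?subr0 //; apply/adic_pi0P.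
have [|r rE] := factor_surj (q := adic_pi A l) p_surj.
  move=> x /(congr1 (adic_ker_val m)); rewrite linear0.
  rewrite -[LHS]/(adic_map f m (adic_pi A m x)) adic_map_pi.
  move=> /adic_pi0P fxm; apply/adic_pi0P.
  have /asboolP[x' x'l /f_inj<- //] : f x \in submod_of D_closed.
  apply: m0P; last by apply/asboolP; exists x.
  by apply: prodmodS fxm; apply/idealX_le/leq_maxr.
exists m, lm, r => y; have [x <-] := p_surj y.
by rewrite rE -[adic_ker_val m _]/(adic_map f m (adic_pi A m x)) !adic_map_pi adic_proj_pi.
Qed.

End ShortExact.
End AdicQuotients.

(** * Exactness properties of generalized local cohomology *)

Section LocalCohomologyClasses.
Variables (R : comNzRingType) (a : submodClosed R^o) (X : lmodType R).
Implicit Types (M N A B C : lmodType R) (i k l m : nat).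

Local Notation T i M := (gen_local_cohomology a i M X).
Local Notation E M i k := (Ext i (quotX a M k) X).

Definition lc_class M i k : {linear E M i k -> T i M} :=
  @colim_in R _ (fun k => Ext_map X (quotX_proj a M k) i) k.
Arguments lc_class {M i k}.

Definition lc_restrict M i k l (kl : (k <= l)%N) : {linear E M i k -> E M i l} :=
  Ext_map X (adic_proj a M kl) i.
Arguments lc_restrict {M i k l} kl.

Lemma lc_class_surj M i (t : T i M) : exists k (e : E M i k), t = lc_class e.
Proof. exact: colim_in_surj. Qed.

Lemma push_lc_restrict M i k l (kl : (k <= l)%N) (e : E M i k) :
  push (fun k => Ext_map X (quotX_proj a M k) i) e l = lc_restrict kl e.
Proof.
have restrict_id m (mm : (m <= m)%N) (e' : E M i m) : lc_restrict mm e' = e'.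
  exact/Ext_map_id/adic_proj_id.
elim: l kl => [|l IHl] kl.
  by case: k e kl => [|k] e kl //; rewrite push_id restrict_id.
have [kl'|lk] := leqP k l.
  rewrite pushS // (IHl kl') /lc_restrict -Ext_map_comp; apply: eq_Ext_map => u.
  exact: adic_proj_step.
have kE : k = l.+1 by apply/eqP; rewrite eqn_leq kl.
by move: e kl {IHl lk}; rewrite kE => e kl; rewrite push_id restrict_id.
Qed.

Lemma lc_class0P M i k (e : E M i k) :
  lc_class e = 0 <-> exists l (kl : (k <= l)%N), lc_restrict kl e = 0.
Proof.
split=> [/colim_in_eq0[l kl e0]|[l [kl e0]]].
  by exists l, kl; rewrite -push_lc_restrict.
by apply/colim_in_eq0; exists l => //; rewrite push_lc_restrict.
Qed.

Lemma lc_class_restrict M i k l (kl : (k <= l)%N) (e : E M i k) :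
  lc_class (lc_restrict kl e) = lc_class e.
Proof.
rewrite -push_lc_restrict; elim: l kl => [|l IHl] kl.
  by case: k e kl => [|k] e kl //; rewrite push_id.
have [kl'|lk] := leqP k l.
  rewrite pushS // -[RHS](IHl kl').
  exact: (@colim_inS R _ (fun k => Ext_map X (quotX_proj a M k) i)).
have kE : k = l.+1 by apply/eqP; rewrite eqn_leq kl.
by move: e {IHl lk}; rewrite kE => e; rewrite push_id.
Qed.

Lemma lc_map_subproof M N (h : {linear M -> N}) i k (e : E N i k) :
  Ext_map X (adic_map a h k.+1) i (Ext_map X (quotX_proj a N k) i e) =
  Ext_map X (quotX_proj a M k) i (Ext_map X (adic_map a h k) i e).
Proof.
rewrite -!Ext_map_comp; apply: eq_Ext_map => u; exact: adic_map_step.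
Qed.

Definition lc_map M N (h : {linear M -> N}) i : {linear T i N -> T i M} :=
  colim_map (@lc_map_subproof M N h i).

Lemma lc_map_class M N (h : {linear M -> N}) i k (e : E N i k) :
  lc_map h i (lc_class e) = lc_class (Ext_map X (adic_map a h k) i e).
Proof. exact: colim_map_in. Qed.

Lemma lc_map_comp M N A (g : {linear N -> A}) (h : {linear M -> N}) i t :
  lc_map (g \o h) i t = lc_map h i (lc_map g i t).
Proof.
have [k [e ->]] := lc_class_surj t; rewrite !lc_map_class -Ext_map_comp.
congr (lc_class _); apply: eq_Ext_map => u; exact: adic_map_comp.
Qed.

Lemma eq_lc_map M N (g h : {linear M -> N}) i t : g =1 h -> lc_map g i t = lc_map h i t.
Proof. by move=> /linear_ext->. Qed.

Lemma lc_map_id M (h : {linear M -> M}) i t : h =1 id -> lc_map h i t = t.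
Proof.
move=> h_id; have [k [e ->]] := lc_class_surj t; rewrite lc_map_class Ext_map_id //.
by move=> u; have [x <-] := adic_pi_surj u; rewrite adic_map_pi h_id.
Qed.

Lemma lc_map_scale M N (h : {linear M -> N}) (c : R) i t :
  lc_map (c \*: h) i t = c *: lc_map h i t.
Proof.
have [k [e ->]] := lc_class_surj t; rewrite !lc_map_class -linearZ; congr (lc_class _).
rewrite -Ext_map_scale; apply: eq_Ext_map => u; exact: adic_map_scale.
Qed.

Section ShortExact.
Variables (A B C : lmodType R) (f : {linear A -> B}) (g : {linear B -> C}).
Hypothesis fg : short_exact f g.
Hypotheses (R_noeth : noetherian R) (B_noeth : noetherian_module B).

(** The kernels of B / a^k B -> C / a^k C and the quotients A / a^k A form cofinal
    systems, so that a class on the former vanishes in the limit as soon as it does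
    so on the latter. *)
Lemma adic_ker_class_vanish i k (e : Ext i (adic_ker a g k) X) :
    lc_class (Ext_map X (adic_ker_in a fg k) i e) = 0 ->
  exists m (km : (k <= m)%N), Ext_map X (adic_ker_proj a g km) i e = 0.
Proof.
move=> /lc_class0P[l [kl el0]].
have [m [lm [r rE]]] := adic_ker_to_quotX a fg l R_noeth B_noeth.
have km := leq_trans kl lm; exists m, km.
rewrite -[RHS](linear0 (Ext_map X r i)) -el0 /lc_restrict -!Ext_map_comp.
apply: eq_Ext_map => y; apply: val_inj.
rewrite -[LHS]/(adic_proj a B km (adic_ker_val a g m y)).
rewrite -[RHS]/(adic_map a f k (adic_proj a A kl (r y))) -adic_proj_map rE.
by rewrite (adic_proj_comp kl lm km).
Qed.

(** A class on B that vanishes on A vanishes on the kernel of B / a^m B -> C / a^m C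
    for m large, where the sequence of Ext applies. *)
Lemma lc_exact i t : lc_map f i t = 0 -> exists c, t = lc_map g i c.
Proof.
have [k [e ->]] := lc_class_surj t; rewrite lc_map_class => fe0.
have [|m [km em0]] := @adic_ker_class_vanish i k (Ext_map X (adic_ker_val a g k) i e).
  by rewrite -Ext_map_comp -[RHS]fe0; congr (lc_class _); apply: eq_Ext_map.
have [|c cE] := Ext_exact (adic_ker_exact a fg m) (e := lc_restrict km e).
  by rewrite -[RHS]em0 /lc_restrict -!Ext_map_comp; apply: eq_Ext_map.
by exists (lc_class c); rewrite lc_map_class -cE lc_class_restrict.
Qed.

Lemma lc_map_inj0 : injective (lc_map g 0).
Proof.
apply: linear_injP => t; have [k [c ->]] := lc_class_surj t.
rewrite lc_map_class => /lc_class0P[m [km]].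
rewrite /lc_restrict -Ext_map_comp => gc0.
apply/lc_class0P; exists m, km.
have {gc0} : Ext_map X (adic_map a g m) 0 (lc_restrict km c) = 0.
  rewrite -[RHS]gc0 -Ext_map_comp; apply: eq_Ext_map => u.
  exact: adic_proj_map.
have [l <-] := ext_class_surj (lc_restrict km c).
rewrite Ext_map_class => /ext_class0P /= lg0; apply/ext_class0P => /= y.
have [_ g_surj _] := fg; have [x <-] := @adic_map_surj R a B C g m g_surj y.
exact: lg0.
Qed.

(** The connecting relation passes to the limit because it is compatible with the
    transition maps ([lc_connected_level]). *)
Definition lc_connected i (z : T i A) (w : T i.+1 C) :=
  exists k (e : Ext i (adic_ker a g k) X) (c : E C i.+1 k),
    [/\ connected (adic_ker_val a g k) (adic_map a g k) e c,
        z = lc_class (Ext_map X (adic_ker_in a fg k) i e) & w = lc_class c].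

Lemma lc_connected_level i k l (kl : (k <= l)%N) (e : Ext i (adic_ker a g k) X) c :
    connected (adic_ker_val a g k) (adic_map a g k) e c ->
  connected (adic_ker_val a g l) (adic_map a g l)
    (Ext_map X (adic_ker_proj a g kl) i e) (lc_restrict kl c).
Proof. by apply: connected_map => // y; apply: adic_proj_map. Qed.

Lemma lc_class_ker_proj i k l (kl : (k <= l)%N) (e : Ext i (adic_ker a g k) X) :
  lc_class (Ext_map X (adic_ker_in a fg l) i (Ext_map X (adic_ker_proj a g kl) i e)) =
  lc_class (Ext_map X (adic_ker_in a fg k) i e).
Proof.
rewrite -(lc_class_restrict kl) /lc_restrict -!Ext_map_comp.
congr (lc_class _); apply: eq_Ext_map => u; apply: val_inj; exact: adic_proj_map.
Qed.

Lemma lc_connected_linear i s z1 w1 z2 w2 :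
  @lc_connected i z1 w1 -> @lc_connected i z2 w2 ->
  @lc_connected i (s *: z1 + z2) (s *: w1 + w2).
Proof.
move=> [k1 [e1 [c1 [ec1 -> ->]]]] [k2 [e2 [c2 [ec2 -> ->]]]].
pose k := maxn k1 k2.
have le1 : (k1 <= k)%N by apply: leq_maxl.
have le2 : (k2 <= k)%N by apply: leq_maxr.
exists k, (s *: Ext_map X (adic_ker_proj a g le1) i e1 + Ext_map X (adic_ker_proj a g le2) i e2).
exists (s *: lc_restrict le1 c1 + lc_restrict le2 c2); split.
- by apply: connected_linear; apply: lc_connected_level.
- by rewrite 2!linearP 2!lc_class_ker_proj.
- by rewrite linearP !lc_class_restrict.
Qed.

Lemma lc_connected_total i w : lc_map g i.+1 w = 0 -> exists z, @lc_connected i z w.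
Proof.
have [k [c ->]] := lc_class_surj w; rewrite lc_map_class => /lc_class0P[l [kl gc0]].
have [|e ec] := connected_total (adic_ker_exact a fg l) (c := lc_restrict kl c).
  rewrite -[RHS]gc0 /lc_restrict -!Ext_map_comp; apply: eq_Ext_map => u.
  exact: adic_proj_map.
exists (lc_class (Ext_map X (adic_ker_in a fg l) i e)), l, e, (lc_restrict kl c).
by split=> //; rewrite lc_class_restrict.
Qed.

Lemma lc_connected_functional i w : @lc_connected i 0 w -> w = 0.
Proof.
case=> k [e [c [ec /esym/adic_ker_class_vanish[m [km em0]] ->]]].
rewrite -(lc_class_restrict km); have := lc_connected_level km ec.
by rewrite em0 => /(connected_functional (adic_ker_exact a fg m))->; rewrite linear0.
Qed.

End ShortExact.

Lemma quotX_torsion N (x : N) k : annihilated a N ->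
  (0 < k)%N -> adic_pi a N k x = 0 -> x = 0.
Proof.
move=> aN; case: k => // k _ /adic_pi0P; move: x.
have cl : GRing.submod_closed (pred1 (0 : N)).
  split=> [|c y z]; rewrite !inE // => /eqP-> /eqP->.
  by rewrite scaler0 addr0.
suff : {subset prodmod (idealX a k.+1) predT <= submod_of cl} by move=> h x /h/eqP.
apply: span_sub => _ /asboolP[c [y [+ _ ->]]]; move: c.
apply: (@span_sub _ _ _ (scalars_into (submod_of cl) y)) => _ /asboolP[c [d [ca _ ->]]].
by rewrite inE -scalerA aN // inE.
Qed.

(** When a annihilates N, the quotients N / a^k N are all equal to N for k > 0, so the
    direct system is constant from rank 1 on. *)
Lemma Ext_lc_torsion N i : annihilated a N ->
  exists2 j : {linear Ext i N X -> T i N}, injective j & surjection j.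
Proof.
move=> aN.
have retract k : exists p : {linear quotX a N k.+1 -> N},
    forall x, p (adic_pi a N k.+1 x) = x.
  have [|p pE] := factor_surj (p := adic_pi a N k.+1) (q := idfun) (@adic_pi_surj _ _ _ _).
    by move=> x; apply: quotX_torsion.
  by exists p.
have [p pE] := retract 0%N.
exists (@lc_class N i 1 \o Ext_map X p i).
  apply: linear_injP => e /lc_class0P[l [l1]].
  rewrite /lc_restrict -Ext_map_comp => e0.
  rewrite -[LHS](@Ext_map_id _ _ _ ((p \o adic_proj a N l1) \o adic_pi a N l)).
    by rewrite Ext_map_comp e0 linear0.
  by move=> x; rewrite -[LHS]/(p (adic_proj a N l1 (adic_pi a N l x))) adic_proj_pi pE.
move=> t; have [k [e ->]] := lc_class_surj t.
pose e1 := lc_restrict (leqnSn k) e.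
have le1k : (1 <= k.+1)%N by [].
exists (Ext_map X (adic_pi a N k.+1) i e1).
pose e2 : E N i 1 := Ext_map X p i (Ext_map X (adic_pi a N k.+1) i e1).
have e2E : lc_restrict le1k e2 = e1.
  rewrite /lc_restrict /e2 -2!Ext_map_comp; apply: Ext_map_id => u.
  have [x <-] := adic_pi_surj u.
  rewrite -[LHS]/(adic_pi a N k.+1 (p (adic_proj a N le1k (adic_pi a N k.+1 x)))).
  by rewrite adic_proj_pi pE.
rewrite -[LHS]/(lc_class e2) -(lc_class_restrict le1k e2) e2E.
exact: lc_class_restrict.
Qed.

End LocalCohomologyClasses.

(** * Finite generation and Serre classes *)

Section FiniteGeneration.
Variable R : comNzRingType.
Implicit Types (M N V W : lmodType R).

Lemma span_ind V (G : {pred V}) (P : V -> Prop) :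
    P 0 -> (forall c x y, P x -> P y -> P (c *: x + y)) -> (forall x, x \in G -> P x) ->
  forall x, x \in span G -> P x.
Proof.
move=> P0 PD PG x; have cl : GRing.submod_closed [pred x | `[< P x >]].
  split=> [|c y z /asboolP Py /asboolP Pz]; apply/asboolP => //; exact: PD.
move=> xG; apply/asboolP; move: x xG; apply: (@span_sub _ _ _ (submod_of cl)) => x xG.
exact/asboolP/PG.
Qed.

Lemma fg_surj V W (g : {linear V -> W}) : surjection g -> fg_module V -> fg_module W.
Proof.
move=> g_surj [s sE]; exists (map g s) => w; rewrite inE; apply/esym.
have [v <-] := g_surj w; have : v \in span [in s] by rewrite -sE.
move: v; apply: span_ind => [|c x y xP yP|x xs].
- by rewrite linear0 rpred0.
- by rewrite linearP rpredD // rpredZ.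
- by rewrite span_in // -[_ \in _]/(g x \in map g s) map_f.
Qed.

Lemma fg_submodW V (N : submodClosed V) : fg_submod N -> fg_module (submod N).
Proof.
case=> s sE; pose t : seq (submod N) := map (insubd (0 : submod N)) s; exists t => y.
rewrite inE; apply/esym.
suff [y' /val_inj<- //] : exists2 y', val y' = val y & y' \in span [in t].
have : val y \in span [in s] by rewrite -sE; exact: (valP y).
move: (val y); apply: span_ind => [|c _ _ [x1 <- x1t] [x2 <- x2t]|x xs].
- by exists 0; rewrite ?rpred0.
- by exists (c *: x1 + x2) => //; rewrite rpredD // rpredZ.
- exists (insubd 0 x); last by rewrite span_in // -[_ \in _]/(_ \in t) map_f.
  by rewrite val_insubd; have -> : x \in submod_pred N by rewrite /submod_pred sE span_in.
Qed.

Lemma fg_submodule V (N : submodClosed V) : noetherian R -> fg_module V -> fg_module (submod N).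
Proof. by move=> R_noeth V_fg; apply/fg_submodW/fg_noetherian. Qed.
End FiniteGeneration.

Section Serre.
Variables (R : comNzRingType) (S : lmodType R -> Prop).
Hypothesis S_serre : serre_subcategory S.
Implicit Types (A B C V W Z : lmodType R).

Lemma serre_quot B C (g : {linear B -> C}) : surjection g -> S B -> S C.
Proof. by move=> /short_exact_ker/(S_serre.2 _ _ _ _ _) SB /SB[]. Qed.

Lemma serre_submod B (N : submodClosed B) : S B -> S (submod N).
Proof. by have /(S_serre.2 _ _ _ _ _) SB := short_exact_quot N => /SB[]. Qed.

Lemma serre_sub A B (j : {linear A -> B}) : injective j -> S B -> S A.
Proof.
move=> j_inj; suff /(S_serre.2 _ _ _ _ _) SB : short_exact j (quotmod_pi (im_lin j)).
  by move=> /SB[].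
split=> [//||y]; [exact: quotmod_pi_surj | rewrite quotmod_pi0P].
by split=> [/asboolP[x ->]|[x <-]]; [exists x | apply/asboolP; exists x].
Qed.

Lemma serre_zero Z : zero_module Z -> S Z.
Proof.
have [[B SB] _] := S_serre => Z0; apply: (@serre_sub _ _ (\0 : {linear Z -> B})) SB.
by move=> x y _; rewrite (Z0 x) (Z0 y).
Qed.

Lemma serre_ext B C (g : {linear B -> C}) :
  S (submod (ker_lin g)) -> S (submod (im_lin g)) -> S B.
Proof.
move=> Sker Sim; have [g' g'_surj g'E] := im_corestrict g.
apply: (S_serre.2 _ _ _ (val : {linear submod (ker_lin g) -> B}) g' _).2 => //.
split=> [|//|x]; [exact: val_inj | split=> [x0|[y <-]]].
  have [|y yE] := @ker_val_onto _ _ _ g x; first by rewrite -g'E x0.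
  by exists y.
by apply: val_inj; rewrite g'E; apply: ker_val0.
Qed.

(** A linear relation that is defined on all of W and functional from Z to W presents W
    as a quotient of a submodule of Z, namely of the graph. *)
Lemma serre_relation Z W (G : Z -> W -> Prop) :
    (forall c z1 w1 z2 w2, G z1 w1 -> G z2 w2 -> G (c *: z1 + z2) (c *: w1 + w2)) ->
    (forall w, exists z, G z w) -> (forall w, G 0 w -> w = 0) ->
  S Z -> S W.
Proof.
move=> G_lin G_total G_fun SZ.
have G_closed : GRing.submod_closed [pred p : Z * W | `[< G p.1 p.2 >]].
  split=> [|c p p' /asboolP Gp /asboolP Gp']; apply/asboolP; last exact: G_lin.
  have [z Gz] := G_total 0; have := G_lin (-1) _ _ _ _ Gz Gz.
  by rewrite !scaleN1r !addNr.
pose graph := submod (submod_of G_closed).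
pose pr1 : {linear graph -> Z} := fst \o (val : {linear graph -> (Z * W)%type}).
pose pr2 : {linear graph -> W} := snd \o (val : {linear graph -> (Z * W)%type}).
apply: (@serre_quot graph _ pr2).
  move=> w; have [z Gzw] := G_total w.
  have zw : (z, w) \in submod_pred (submod_of G_closed) by apply/asboolP.
  by exists (Submod zw).
apply: (@serre_sub _ _ pr1) SZ; apply: linear_injP => -[[z w] /= zwP] /= z0.
apply: val_inj => /=; have /asboolP := zwP; rewrite /= in z0 *; rewrite z0 => /G_fun->.
by [].
Qed.

Lemma serre_ext_complex A B C (g : {linear A -> B}) (h : {linear B -> C}) :
    (forall x, h (g x) = 0) ->
  S (submod (ker_lin g)) -> S (submod (ker_lin h)) -> S A.
Proof.
move=> hg0 Sg Sh; apply: (serre_ext Sg).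
have sub (y : submod (im_lin g)) : val y \in submod_pred (ker_lin h).
  by have /asboolP[x ->] := valP y; apply/eqP.
have sub_lin : linear (fun y => Submod (sub y)).
  by move=> c y z; apply: val_inj.
apply: (serre_sub (j := linear_of sub_lin)) Sh => y z /(congr1 val) /= yz.
exact: val_inj.
Qed.

Section Pullback.
Variables (W V V' : lmodType R) (j : {linear W -> V}) (q : {linear V' -> V}).

Definition pullback : {pred V'} := [pred c | `[< exists w, q c = j w >]].
Lemma pullback_closed : GRing.submod_closed pullback.
Proof.
split=> [|c t1 t2 /asboolP[w1 w1E] /asboolP[w2 w2E]]; apply/asboolP.
  by exists 0; rewrite !linear0.
by exists (c *: w1 + w2); rewrite !linearP w1E w2E.
Qed.
HB.instance Definition _ := GRing.isSubmodClosed.Build R V' pullback pullback_closed.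

(** By exactness the part of W killed by p is the image of the part of V' that q maps
    into W. *)
Lemma serre_pullback V'' (p : {linear V -> V''}) :
    injective j -> (forall t, p t = 0 -> exists c, t = q c) ->
  S (submod pullback) -> S (submod (ker_lin (p \o j))).
Proof.
move=> j_inj qp.
pose G (c : submod pullback) (w : submod (ker_lin (p \o j))) := q (val c) = j (val w).
apply: (serre_relation (G := G)).
- by move=> c z1 w1 z2 w2; rewrite /G /= !linearP => -> ->.
- move=> w; have /eqP w0 : val w \in ker_lin (p \o j) := valP w.
  have [c cE] := qp _ w0.
  have cP : c \in submod_pred pullback by apply/asboolP; exists (val w).
  by exists (Submod cP).
- move=> w; rewrite /G linear0 -(linear0 j) => /j_inj w0.
  exact/val_inj/esym.
Qed.
End Pullback.

End Serre.

Lemma zero_module_serre (R : comNzRingType) : serre_subcategory (@zero_module R).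
Proof.
split; first by exists (submod (ker_lin (idfun : {linear R^o -> R^o}))) => x;
  apply: val_inj; apply/eqP; exact: (valP x).
move=> X' X X'' f g [f_inj g_surj fg]; split=> [X0|[X'0 X''0] x].
  split=> [x|z]; first by apply: f_inj; rewrite (X0 (f x)) linear0.
  by have [y <-] := g_surj z; rewrite (X0 y) linear0.
have [x' <-] := (fg x).1 (X''0 (g x)).
by rewrite (X'0 x') linear0.
Qed.

(** * Local cohomology modulo a Serre class *)

Section SerreLocalCohomology.
Variables (R : comNzRingType) (a : submodClosed R^o) (X : lmodType R).
Variable S : lmodType R -> Prop.
Hypotheses (R_noeth : noetherian R) (S_serre : serre_subcategory S).
Implicit Types (M N A B C V W Z : lmodType R).

Local Notation T i M := (gen_local_cohomology a i M X).
Local Notation lcm := (lc_map a X).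

Lemma serre_ker_surj A B C (f : {linear A -> B}) (g : {linear B -> C}) i :
    short_exact f g -> fg_module B -> (forall j, i = j.+1 -> S (T j A)) ->
  S (submod (ker_lin (lcm g i))).
Proof.
move=> fg /(fg_noetherian R_noeth) B_noeth; case: i => [|j] SA.
  apply: (serre_zero S_serre) => t; apply: val_inj; apply: (lc_map_inj0 fg).
  by rewrite linear0; apply/eqP; exact: (valP t).
pose G (z : T j A) (w : submod (ker_lin (lcm g j.+1))) := lc_connected fg z (val w).
apply: (serre_relation S_serre (G := G)) (SA j erefl).
- by move=> c z1 w1 z2 w2; apply: lc_connected_linear.
- move=> w; apply: (lc_connected_total fg); apply/eqP; exact: (valP w).
- move=> w /(lc_connected_functional R_noeth B_noeth) w0; exact: val_inj.
Qed.

Lemma serre_ker_inj A B C (f : {linear A -> B}) (g : {linear B -> C}) i :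
    short_exact f g -> fg_module B -> S (T i C) -> S (submod (ker_lin (lcm f i))).
Proof.
move=> fg /(fg_noetherian R_noeth) B_noeth.
pose G (z : T i C) (w : submod (ker_lin (lcm f i))) := lcm g i z = val w.
apply: (serre_relation S_serre (G := G)).
- by move=> c z1 w1 z2 w2; rewrite /G linearP => -> ->.
- move=> w; have /eqP w0 : val w \in ker_lin (lcm f i) := valP w.
  by have [c cE] := lc_exact fg R_noeth B_noeth w0; exists c.
- by move=> w; rewrite /G linear0 => w0; apply: val_inj.
Qed.

Lemma lc_zero_module N i : zero_module N -> zero_module (T i N).
Proof.
move=> N0 t; rewrite -[t](@lc_map_id _ _ _ _ (0 \*: idfun)) => [|x].
  by rewrite lc_map_scale scale0r.
by rewrite (N0 x) linear0.
Qed.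

Lemma span_nil_zero N : (predT : {pred N}) =i span [in [::] : seq N] -> zero_module N.
Proof. by move=> NE x; apply: span_nil; rewrite -NE. Qed.

(** Induction on i, then on the number of generators of N.  For x a generator,
    0 -> R x -> N -> N / R x -> 0 reduces the question to N / R x, which has one
    generator less, and to R x; for the latter, the kernel of R -> R x is covered
    by the induction on i, and T^i(R) is in S by hypothesis. *)
Lemma serre_lc n : (forall r, (r < n)%N -> S (local_cohomology a r X)) ->
  forall i N, (i < n)%N -> fg_module N -> S (T i N).
Proof.
move=> SX; elim/ltn_ind=> i IHi N i_n [s]; move Ek: (size s) => k.
elim: k N s Ek => [|k IHk] N [|x s] // Ek NE.
  by apply/(serre_zero S_serre)/lc_zero_module/span_nil_zero.
have N_fg : fg_module N by exists (x :: s).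
have h_lin : linear (fun r : R^o => (r : R) *: x : N).
  by move=> c r1 r2; rewrite scalerDl -scalerA.
pose h := linear_of h_lin; pose Rx := submod (im_lin h).
have [h' h'_surj _] := im_corestrict h.
have Rfg : fg_module (R^o : lmodType R).
  exists [:: 1] => r; rewrite inE; apply/esym.
  by rewrite -[r]mulr1 -[r * 1]/(r *: (1 : R^o)) rpredZ // span_in // mem_head.
apply: (serre_ext S_serre (g := lcm (val : {linear Rx -> N}) i)).
  apply: (serre_ker_inj (short_exact_quot (im_lin h))) => //.
  apply: (IHk _ (map (quotmod_pi (im_lin h)) s)) => [|u]; first by rewrite size_map; case: Ek.
  rewrite inE; apply/esym; rewrite -[u]quotmod_reprK; move: (quotmod_repr u) => y.
  have /span_cons[r [z [zs ->]]] : y \in span [in x :: s] by rewrite -NE.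
  have rx0 : quotmod_pi (im_lin h) (r *: x) = 0.
    by apply/quotmod_pi0P/asboolP; exists r.
  rewrite linearD [X in X + _]rx0 add0r; move: z zs; apply: span_ind => [|c y1 y2 y1s y2s|y1 y1s].
  - by rewrite linear0 rpred0.
  - by rewrite linearP rpredD // rpredZ.
  - by rewrite span_in // -[_ \in _]/(_ \in map _ s) map_f.
apply: (serre_submod S_serre); apply: (serre_ext S_serre (g := lcm h' i)).
  apply: (serre_ker_surj (short_exact_ker h'_surj)) => // j ji.
  apply: IHi; rewrite ?ji //; first by rewrite (leq_trans _ i_n) // ji.
  exact: fg_submodule.
exact/(serre_submod S_serre)/SX.
Qed.

End SerreLocalCohomology.

Section JointKernel.
Variables (R : comNzRingType) (a : submodClosed R^o) (X : lmodType R).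
Variable S : lmodType R -> Prop.
Hypotheses (R_noeth : noetherian R) (S_serre : serre_subcategory S).
Implicit Types (M N A B C V W Z : lmodType R).

Local Notation T i M := (gen_local_cohomology a i M X).
Local Notation lcm := (lc_map a X).

Definition images M N (L : seq {linear M -> N}) : {pred N} :=
  [pred y | `[< exists2 f, f \in L & exists x, y = f x >]].

(** The elements of T^i(N) killed by all the maps induced by the f in L form a module
    of S, stated for any W embedded among them.  Induction on L: those that vanish on
    the image f M of the first map come from T^i(N / f M), where one map less is left;
    the restrictions of the others to f M lie in the kernel of T^i(f M) -> T^i(M),
    which is in S since M -> f M is surjective. *)
Lemma serre_joint_kernel n M : (forall r, (r < n)%N -> S (local_cohomology a r X)) ->
    fg_module M ->
  forall i N (L : seq {linear M -> N}) W (j : {linear W -> T i N}),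
    (i <= n)%N -> fg_module N -> (forall y, y \in span (images L)) -> injective j ->
    (forall w f, f \in L -> lcm f i (j w) = 0) ->
  S W.
Proof.
move=> SX M_fg i N L; move Ek: (size L) => k.
elim: k N L Ek => [|k IHk] N [|f L] // Ek W j i_n N_fg NL j_inj jL.
  apply: (serre_zero S_serre) => w; apply: j_inj; rewrite linear0.
  apply: lc_zero_module => y; move: y (NL y).
  apply: span_ind => // [c y1 y2 -> ->|y /asboolP[g //]].
  by rewrite scaler0 addr0.
pose fM := submod (im_lin f); pose q : {linear N -> quotmod (im_lin f)} := quotmod_pi (im_lin f).
pose inc : {linear fM -> N} := val.
have qf0 x : q (f x) = 0 by apply/quotmod_pi0P/asboolP; exists x.
have inc_q : short_exact inc q by exact: short_exact_quot.
have N_noeth := fg_noetherian R_noeth N_fg.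
have [f' f'_surj f'E] := im_corestrict f.
have incf' t : lcm f' i (lcm inc i t) = lcm f i t.
  by rewrite -lc_map_comp; apply: eq_lc_map.
apply: (serre_ext_complex S_serre (g := lcm inc i \o j) (h := lcm f' i)).
- by move=> w; rewrite -[LHS]/(lcm f' i (lcm inc i (j w))) incf' jL // mem_head.
- apply: (serre_pullback S_serre (q := lcm q i) j_inj).
    by move=> t; apply: lc_exact inc_q R_noeth N_noeth _ _.
  pose qL (g : {linear M -> N}) : {linear M -> quotmod (im_lin f)} := q \o g.
  apply: (IHk _ (map qL L) _ _ (val : {linear submod (pullback j (lcm q i)) -> _})) => //.
  - by rewrite size_map; case: Ek.
  - by apply: (fg_surj (g := q)) N_fg; case: inc_q.
  - move=> u; have [_ q_surj _] := inc_q; have [y <-] := q_surj u.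
    move: y (NL y); apply: span_ind => [|c y1 y2 y1L y2L|_ /asboolP[g gL [x ->]]].
    + by rewrite linear0 rpred0.
    + by rewrite linearP rpredD // rpredZ.
    + move: gL; rewrite inE => /predU1P[->|gL]; first by rewrite qf0 rpred0.
      apply: span_in; apply/asboolP; exists (qL g); last by exists x.
      exact: map_f.
  - exact: val_inj.
  - move=> c _ /mapP[g gL ->]; rewrite [LHS]lc_map_comp.
    have /asboolP[w ->] := valP c.
    by apply: jL; rewrite inE gL orbT.
- apply: (serre_ker_surj R_noeth S_serre (short_exact_ker f'_surj)) => // r ri.
  apply: (serre_lc R_noeth S_serre SX); first by rewrite -ri.
  exact: fg_submodule.
Qed.

End JointKernel.

(** * The part annihilated by the ideal *)

Section AnnihilatedPart.
Variables (R : comNzRingType) (a : submodClosed R^o).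
Implicit Types (M N T : lmodType R).

Definition aM M := prodmod a (predT : {pred M}).

Lemma annihilated_quot M : annihilated a (quotmod (aM M)).
Proof.
move=> c u ca; have [x <-] := quotmod_pi_surj u.
rewrite -linearZ; apply/quotmod_pi0P/span_in/asboolP; by exists c, x.
Qed.

Definition unit_class : quotmod a := quotmod_pi a (1 : R^o).

Lemma unit_classE (c : R) : quotmod_pi a (c : R^o) = c *: unit_class.
Proof. by rewrite -linearZ; congr (quotmod_pi a); rewrite -[RHS]/(c * 1) mulr1. Qed.

Section Evaluation.
Variable T : lmodType R.

(** Evaluation at 1 identifies Hom(R/a, T) with the submodule of T annihilated by a:
    see [eval1_inj], [eval1_annihilated] and [eval1_onto]. *)
Definition eval1 (f : {linear quotmod a -> T}) : T := f unit_class.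
Lemma eval1_linear : linear eval1.
Proof. by []. Qed.
HB.instance Definition _ :=
  GRing.isLinear.Build R {linear quotmod a -> T} T _ eval1 eval1_linear.

Lemma eval1_inj : injective eval1.
Proof.
move=> f g fg; apply/linear_ext => u; rewrite -[u]quotmod_reprK unit_classE.
by rewrite !linearZ; congr (_ *: _).
Qed.

Lemma eval1_annihilated f (c : R) : (c : R^o) \in a -> c *: eval1 f = 0.
Proof.
move=> ca; have c0 : c *: unit_class = 0.
  by rewrite -unit_classE; apply/quotmod_pi0P.
by rewrite /eval1 -linearZ c0 linear0.
Qed.

Lemma eval1_onto t : (forall c : R, (c : R^o) \in a -> c *: t = 0) ->
  exists f, eval1 f = t.
Proof.
move=> ta; have t_lin : linear (fun c : R^o => (c : R) *: t).
  by move=> c r1 r2; rewrite scalerDl -scalerA.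
have [||f fE] := factor_surj (p := quotmod_pi a) (q := linear_of t_lin).
- exact: quotmod_pi_surj.
- by move=> c /quotmod_pi0P; apply: ta.
by exists f; rewrite /eval1 /unit_class fE -[LHS]/(1 *: t) scale1r.
Qed.
End Evaluation.

Lemma lc_map_annihilated (X M N : lmodType R) (q : {linear M -> N}) i c
    (t : gen_local_cohomology a i N X) :
  annihilated a N -> c \in a -> (c : R) *: lc_map a X q i t = 0.
Proof.
move=> N0 ca; rewrite -lc_map_scale.
transitivity (lc_map a X (0 \*: q) i t); last by rewrite lc_map_scale scale0r.
apply: eq_lc_map => x; rewrite -[LHS]/(c *: q x) -[RHS]/(0 *: q x) scale0r.
exact: N0.
Qed.

End AnnihilatedPart.

Section MainArgument.
Variables (R : comNzRingType) (a : submodClosed R^o) (M X : lmodType R) (n : nat).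
Hypotheses (R_noeth : noetherian R) (M_fg : fg_module M).

Local Notation T i M := (gen_local_cohomology a i M X).
Local Notation lcm := (lc_map a X).
Local Notation Mbar := (quotmod (aM a M)).
Local Notation Hom_T := {linear quotmod a -> T n M}.

Definition Mbar_pi : {linear M -> Mbar} := quotmod_pi (aM a M).
Definition aM_inc : {linear submod (aM a M) -> M} := val.

Lemma aM_exact : short_exact aM_inc Mbar_pi.
Proof. exact: short_exact_quot. Qed.

(** The error term: it measures how far the part of T^n(M) annihilated by a is from
    coming from T^n(M / aM). *)
Definition restrict_aM : {linear Hom_T -> T n (submod (aM a M))} :=
  lcm aM_inc n \o @eval1 R a (T n M).

(** Multiplication by a generator c of a is a map F c : M -> aM whose composite with
    the inclusion of aM in M is multiplication by c; thus the map induced by F c kills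
    the restriction to aM of anything annihilated by a.  The images of the F c
    generate aM. *)
Lemma serre_im_restrict_aM (S : lmodType R -> Prop) : serre_subcategory S ->
    (forall r, (r < n)%N -> S (local_cohomology a r X)) ->
  S (submod (im_lin restrict_aM)).
Proof.
move=> S_serre SX; have [s sE] := R_noeth a.
have /choice[F FE] : forall c : R^o, exists f : {linear M -> submod (aM a M)},
    c \in a -> forall x, aM_inc (f x) = (c : R) *: x.
  move=> c; have [ca|_] := boolP (c \in a); last by exists \0.
  have [|f fE] := factor_inj (i := aM_inc) (q := (c : R) \*: idfun) val_inj.
    move=> x; have cx : (c : R) *: x \in submod_pred (aM a M).
      by apply: span_in; apply/asboolP; exists c, x.
    by exists (Submod cx).
  by exists f => _ x; rewrite fE.
have sa c : c \in s -> c \in a by move=> cs; rewrite sE span_in.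
apply: (@serre_joint_kernel R a X S R_noeth S_serre n M SX M_fg n _ (map F s) _
  (val : {linear submod (im_lin restrict_aM) -> _})) => //.
- exact: fg_submodule.
- move=> y; suff [y' /val_inj<- //] : exists2 y', val y' = val y & y' \in span (images (map F s)).
  pose P := im_lin (aM_inc \o (val : {linear submod (span (images (map F s))) -> _})).
  suff PaM : {subset aM a M <= P}.
    have /PaM/asboolP[z zE] : val y \in aM a M := valP y.
    by exists (val z) => //; exact: (valP z).
  apply: span_sub => _ /asboolP[c [x [+ _ ->]]]; rewrite sE; move: c.
  apply: (@span_sub _ _ _ (scalars_into P x)) => c cs; rewrite inE; apply/asboolP.
  have Fcx : F c x \in submod_pred (span (images (map F s))).
    by apply: span_in; apply/asboolP; exists (F c); [exact: map_f | exists x].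
  by exists (Submod Fcx); rewrite -[RHS]/(aM_inc (F c x)) FE ?sa.
- exact: val_inj.
- move=> w _ /mapP[c cs ->]; have /asboolP[f fE] := valP w.
  apply: etrans (congr1 (lcm (F c) n) fE) _.
  rewrite -[LHS]/(lcm (F c) n (lcm aM_inc n (eval1 f))) -lc_map_comp.
  rewrite (@eq_lc_map _ _ _ _ _ _ ((c : R) \*: idfun)) => [|x].
    by rewrite lc_map_scale lc_map_id // eval1_annihilated ?sa.
  exact: FE (sa _ cs) x.
Qed.

(** By exactness, what [restrict_aM] kills comes from T^n(M / aM). *)
Lemma Hom_serre (S : lmodType R -> Prop) : serre_subcategory S ->
    (forall r, (r < n)%N -> S (local_cohomology a r X)) ->
  S (Ext n Mbar X) -> S Hom_T.
Proof.
move=> S_serre SX SExt; apply: (serre_ext S_serre (g := restrict_aM)).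
  have [jE _ jE_surj] := Ext_lc_torsion X n (@annihilated_quot R a M).
  pose ev : {linear submod (ker_lin restrict_aM) -> T n M} := @eval1 R a (T n M) \o val.
  pose G (z : T n Mbar) (f : submod (ker_lin restrict_aM)) := lcm Mbar_pi n z = ev f.
  apply: (serre_relation S_serre (G := G)) (serre_quot S_serre jE_surj SExt).
  - by move=> c z1 f1 z2 f2 e1 e2; rewrite /G 2!linearP e1 e2.
  - move=> f; have /eqP f0 : val f \in ker_lin restrict_aM := valP f.
    have [z zE] := lc_exact aM_exact R_noeth (fg_noetherian R_noeth M_fg) f0.
    by exists z.
  - move=> f; rewrite /G linear0 => f0; apply/val_inj/eval1_inj.
    by rewrite -[LHS]/(ev f) -f0 linear0.
exact: serre_im_restrict_aM.
Qed.

(** Take S to be the class of zero modules: then T^n(M / aM) embeds in T^n(M) and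
    [restrict_aM] is zero, so the image of T^n(M / aM) is the whole part annihilated
    by a. *)
Lemma Hom_iso : (forall r, (r < n)%N -> zero_module (local_cohomology a r X)) ->
  isomorphic Hom_T (Ext n Mbar X).
Proof.
move=> X0; have S0 := zero_module_serre R.
have aM_fg : fg_module (submod (aM a M)) by exact: fg_submodule.
have [jE jE_inj jE_surj] := Ext_lc_torsion X n (@annihilated_quot R a M).
have pi_inj : injective (lcm Mbar_pi n).
  apply: linear_injP => t t0.
  have t_ker : t \in submod_pred (ker_lin (lcm Mbar_pi n)) by apply/eqP.
  apply: (congr1 val (_ : Submod t_ker = 0)).
  apply: (serre_ker_surj R_noeth S0 aM_exact M_fg) => j nj.
  by apply: (serre_lc R_noeth S0 X0) aM_fg; rewrite nj.
have restrict0 f : restrict_aM f = 0.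
  have f_im : restrict_aM f \in submod_pred (im_lin restrict_aM).
    by apply/asboolP; exists f.
  exact: (congr1 val (serre_im_restrict_aM S0 X0 (Submod f_im))).
apply: (@isomorphic_same_image _ _ _ _ (@eval1 R a (T n M)) (lcm Mbar_pi n \o jE)).
- exact: eval1_inj.
- exact: inj_comp.
- move=> f; have [z zE] := lc_exact aM_exact R_noeth (fg_noetherian R_noeth M_fg) (restrict0 f).
  have [e eE] := jE_surj z; exists e.
  exact: etrans (congr1 (lcm Mbar_pi n) eE) (esym zE).
- move=> e; apply: eval1_onto => c; exact: lc_map_annihilated (@annihilated_quot R a M).
Qed.

End MainArgument.

Theorem theorem2p10 (R : comNzRingType) (a : submodClosed R^o)
    (S : lmodType R -> Prop) (M X : lmodType R) (n : nat) :
  noetherian R -> serre_subcategory S -> fg_module M ->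
  ((forall r : nat, (r < n)%N -> S (local_cohomology a r X)) ->
    S (Ext n (quotmod (prodmod a (predT : {pred M}))) X) ->
    S {linear quotmod a -> gen_local_cohomology a n M X})
  /\
  ((forall r : nat, (r < n)%N -> zero_module (local_cohomology a r X)) ->
    isomorphic {linear quotmod a -> gen_local_cohomology a n M X}
               (Ext n (quotmod (prodmod a (predT : {pred M}))) X)).
Proof.
move=> R_noeth S_serre M_fg; split; first exact: Hom_serre.
exact: Hom_iso.
Qed.
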